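(* Let $n\ge 1$ and let $X(\mathbb B_n)$ and $Y(\mathbb B_n)$ be Banach spaces of analytic functions on $\mathbb B_n$, with norms $\|\cdot\|_X$ and $\|\cdot\|_Y$, both containing the constant functions, such that the following three conditions hold. (I) The topologies induced by $\|\cdot\|_X$ and $\|\cdot\|_Y$ are both finer than the compact-open topology. (II) For some integer $N\ge 1$ it holds that $\|f\|_X\asymp |f(0)|+\|R^Nf\|_Y$ for all $f\in\mathcal H(\mathbb B_n)$. (III) $H^\infty(\mathbb B_n)\subset M(Y(\mathbb B_n))$. Let $u\in M(X(\mathbb B_n))$ and let $M_u:X(\mathbb B_n)\to X(\mathbb B_n)$, $M_uf=uf$. Then the spectrum of $M_u$ is $\sigma(M_u)=\overline{u(\mathbb B_n)}$.
   Context: $\mathbb B_n$ is the open unit ball of $\mathbb C^n$; $\mathcal H(\mathbb B_n)$ is the space of all analytic functions $\mathbb B_n\to\mathbb C$; $H^\infty(\mathbb B_n)$ is the space of bounded ones. For a Banach space $Z\subset\mathcal H(\mathbb B_n)$, $M(Z)=\{u\in\mathcal H(\mathbb B_n): uf\in Z\text{ for all }f\in Z\}$. Under (I), each $u\in M(X(\mathbb B_n))$ induces a bounded operator $M_u$ on $X(\mathbb B_n)$ by the closed graph theorem. If $f=\sum_{k\ge0}f_k$ is the homogeneous expansion of $f\in\mathcal H(\mathbb B_n)$, then $R^Nf=\sum_{k\ge1}k^Nf_k$. The notation $a\asymp b$ means that $C^{-1}a\le b\le Ca$ with a constant $C>0$ independent of $f$; in (II) a norm is understood as $+\infty$ for functions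 not in the space, so (II) includes that $f\in X(\mathbb B_n)$ if and only if $R^Nf\in Y(\mathbb B_n)$. *)

(* Defs.v *)
From HB Require Import structures.
From mathcomp Require Import all_boot all_order all_algebra.
From mathcomp.real_closed Require Import complex.
From mathcomp Require Import all_classical all_reals all_analysis.

Set Implicit Arguments.
Unset Strict Implicit.
Unset Printing Implicit Defensive.

Import Order.TTheory GRing.Theory Num.Theory.
Import numFieldNormedType.Exports.

Local Open Scope classical_set_scope.
Local Open Scope ring_scope.

(* The complex field, typed as a numClosedFieldType: this is the class on which
   MathComp-Analysis puts the topology and the norm of the modulus. In
   particular norms over [Cplx R] are nonnegative elements of [Cplx R]. *)
Definition Cplx (R : realType) : numClosedFieldType := R[i].

Definition Bn (R : realType) (n : nat) : set 'rV[Cplx R]_n :=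
  [set z | \sum_i `|z 0 i| ^+ 2 < 1].
Arguments Bn R n : clear implicits.

Lemma Bn_0 (R : realType) (n : nat) : (0 : 'rV[Cplx R]_n) \in Bn R n.
Proof.
by apply/mem_set; rewrite /Bn /= big1 ?ltr01// => i _; rewrite mxE normr0 expr0n.
Qed.

(* Functions on the ball are functions on the subtype [Bn R n]. *)
Definition Bn_center (R : realType) (n : nat) : Bn R n := exist _ 0 (Bn_0 R n).

Section PowerSeries.
Variables (R : realType) (n : nat).
Local Notation C := (Cplx R).
Implicit Types (c : ('I_n -> nat) -> C) (w : 'rV[C]_n) (f : Bn R n -> C).

Definition monomial (alpha : 'I_n -> nat) w : C := \prod_i w 0 i ^+ alpha i.

(* The k-homogeneous part, the sum over |alpha| = k of c_alpha w^alpha; the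
   entries of such an alpha are at most k, which makes the sum finite. *)
Definition hpart c (k : nat) w : C :=
  \sum_(alpha : {ffun 'I_n -> 'I_k.+1} | (\sum_i alpha i == k)%N)
    c (fun i => alpha i) * monomial (fun i => alpha i) w.

Definition abs_hpart c (k : nat) w : C :=
  \sum_(alpha : {ffun 'I_n -> 'I_k.+1} | (\sum_i alpha i == k)%N)
    `|c (fun i => alpha i) * monomial (fun i => alpha i) w|.

(* Absolute convergence of the multiple power series, with sum s. *)
Definition power_series_cvg c w (s : C) : Prop :=
  cvgn (series (fun k => abs_hpart c k w)) /\
  series (fun k => hpart c k w) @ \oo --> s.

Definition analytic f : Prop :=
  forall a : Bn R n, exists (r : R) (c : ('I_n -> nat) -> C), 0 < r /\
    forall z : Bn R n, \sum_i `|(\val z - \val a) 0 i| ^+ 2 < (r ^+ 2)%:C%C ->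
      power_series_cvg c (\val z - \val a) (f z).

(* The coefficients of the homogeneous expansion f = sum_k f_k on the ball,
   where f_k = hpart (taylor_coef f) k. They exist and are unique for analytic
   f; the value for other f is irrelevant. *)
Definition taylor_coef f : ('I_n -> nat) -> C :=
  xget (fun=> 0) [set c | forall z : Bn R n,
    series (fun k => hpart c k (\val z)) @ \oo --> f z].

Definition radial (N : nat) f : Bn R n -> C := fun z =>
  limn (fun m => \sum_(1 <= k < m) k%:R ^+ N * hpart (taylor_coef f) k (\val z)).

End PowerSeries.

(* A complex Banach space together with its identification with a linear space
   of analytic functions on the ball. *)
Record banach_fun_space (R : realType) (n : nat) := BanachFunSpace {
  bfs_space :> completeNormedModType (Cplx R) ;
  bfs_fun : {linear bfs_space -> (Bn R n -> (Cplx R)^o)} ;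
  bfs_inj : injective bfs_fun ;
  bfs_analytic : forall x : bfs_space, analytic (bfs_fun x) }.
Arguments bfs_fun {R n b}.

Section FunctionSpaces.
Variables (R : realType) (n : nat).
Local Notation C := (Cplx R).
Implicit Types (Z : banach_fun_space R n) (f u : Bn R n -> C).

Definition contains_constants Z : Prop :=
  forall a : C, exists x : Z, bfs_fun x = (fun=> a).

Definition finer_than_compact_open Z : Prop :=
  continuous (bfs_fun : Z -> {compact-open, Bn R n -> C}).

(* The norm of f, with value +oo if f is not in Z (infimum of the empty set);
   otherwise the set is a singleton. *)
Definition enorm Z f : \bar R :=
  ereal_inf [set (complex.Re `|x|)%:E | x in [set x : Z | bfs_fun x = f]].

Definition Hinfty : set (Bn R n -> C) :=
  [set u | analytic u /\ bounded_fun (u : Bn R n -> C^o)].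

Definition multiplier Z : set (Bn R n -> C) :=
  [set u | analytic u /\
    forall x : Z, exists y : Z, bfs_fun y = (fun z => u z * bfs_fun x z)].

(* The operator M_u for u in M(Z); y is then unique by injectivity. *)
Definition mult_op Z u : Z -> Z := fun x =>
  xget 0 [set y : Z | bfs_fun y = (fun z => u z * bfs_fun x z)].

Definition norm_equivalence (N : nat) (X Y : banach_fun_space R n) : Prop :=
  exists2 K : R, 0 < K & forall f, analytic f ->
    let b := ((complex.Re `|f (Bn_center R n)|)%:E + enorm Y (radial N f))%E in
    (K^-1%:E * b <= enorm X f)%E /\ (enorm X f <= K%:E * b)%E.

End FunctionSpaces.

Arguments mult_op {R n} Z u.
Arguments Hinfty R n : clear implicits.

Definition spectrum (R : realType) (V : completeNormedModType (Cplx R))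
    (T : V -> V) : set (Cplx R) :=
  [set lambda | ~ exists S : {linear V -> V}, [/\ continuous S,
     forall x, S (T x - lambda *: x) = x &
     forall x, T (S x) - lambda *: S x = x]].

(* Main.v *)
Require Import Defs.
From HB Require Import structures.
From mathcomp Require Import all_boot all_order all_algebra.
From mathcomp Require Import separable cyclic cyclotomic.
From mathcomp.real_closed Require Import complex.
From mathcomp Require Import all_classical all_reals all_analysis.
From mathcomp Require Import ring lra.

(* Let v = u - lambda. If lambda is not in the closure of the range of u, then
   1/v is bounded and analytic. At a fixed point z the function
   (v(z) - v)^(N+1) f/v vanishes to order N+1, so that R^N kills it there;
   expanding the binomial gives
     R^N(f/v) = sum_(j <= N) (-1)^j C(N+1,j+1) v^(-j-1) R^N(v^j f),
   which is in Y by (II) and (III). Hence f/v is in X, and division by v is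
   bounded by the closed graph theorem. Conversely, if S inverts M_u - lambda and
   1 is the constant function, then S^k 1 = (S 1)^k, so that
   |S 1(z)|^k <= C_z |S|^k for all k; hence 1/|u - lambda| = |S 1| <= |S| on the
   ball.

   The homogeneous expansion on the whole ball is obtained on the complex lines
   through 0: a function of one variable that is locally a power series
   satisfies the maximum principle, the maximum principle applied to averages
   over roots of unity gives Cauchy's estimates, and these make the expansion at
   0 converge on the whole disc. *)

Set Implicit Arguments.
Unset Strict Implicit.
Unset Printing Implicit Defensive.

Import Order.TTheory GRing.Theory Num.Theory.
Import numFieldNormedType.Exports.

Local Open Scope classical_set_scope.
Local Open Scope ring_scope.

(** * The modulus as a real number *)

(** A direct Leibniz rule for [R^N(f/v)] produces products of lower-order derivatives of [v] and
    [f], which the hypotheses do not place in [Y]. The binomial identity avoids them: every [v^j f]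
    lies in [X] because [v] multiplies [X], so [R^N(v^j f)] is in [Y], and the powers of [1/v] act
    afterwards as multipliers of [Y].

    In the converse inclusion the evaluation at [z] is continuous with a constant depending on [z];
    passing to the powers of [S] is what removes this constant and leaves a bound uniform on the
    ball.

    The analytic groundwork is due to a mismatch: analyticity is local, while [radial] is defined
    from one expansion valid on the entire ball. For fixed [z] everything is read on the function
    [x |-> f(xz)], analytic on a disc of radius larger than 1; there [R^N f(z)] is [(x d/dx)^N] at
    [x = 1], and products of functions become Cauchy products of coefficient sequences. *)

Section Modulus.
Variable R : realType.
Local Notation C := (Cplx R).

(* The library norm of a complex space takes its values in [Cplx R]; [mod] is
   the same number as a real. *)
Definition mod (V : normedZmodType C) (x : V) : R := complex.Re `|x|.

Section Norm.
Variable V : normedZmodType C.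
Implicit Types x y : V.

Lemma normE x : `|x| = (mod x)%:C%C.
Proof. by rewrite /mod RRe_real// normr_real. Qed.

Lemma mod_ge0 x : 0 <= mod x.
Proof. by rewrite -ler0c -normE. Qed.

Lemma mod0 : mod (0 : V) = 0.
Proof. by rewrite /mod normr0. Qed.

Lemma mod_eq0 x : (mod x == 0) = (x == 0).
Proof. by rewrite -[x == 0]normr_eq0 normE -(inj_eq (@complexI R)). Qed.

Lemma modN x : mod (- x) = mod x.
Proof. by rewrite /mod normrN. Qed.

Lemma modBC x y : mod (x - y) = mod (y - x).
Proof. by rewrite /mod distrC. Qed.

Lemma modD x y : mod (x + y) <= mod x + mod y.
Proof. by rewrite -lecR rmorphD /= -!normE ler_normD. Qed.

Lemma modB x y : mod (x - y) <= mod x + mod y.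
Proof. by rewrite (le_trans (modD _ _))// modN. Qed.

Lemma modBl x y : mod x - mod y <= mod (x - y).
Proof. by have := modD (x - y) y; rewrite subrK; lra. Qed.

Lemma mod_sum (I : Type) (r : seq I) (P : pred I) (F : I -> V) :
  mod (\sum_(i <- r | P i) F i) <= \sum_(i <- r | P i) mod (F i).
Proof.
elim/big_ind2 : _ => [|x1 x2 y1 y2 h1 h2|//]; first by rewrite mod0.
by rewrite (le_trans (modD _ _))// lerD.
Qed.

End Norm.

Lemma modM (x y : C) : mod (x * y) = mod x * mod y.
Proof. by apply: (@complexI R); rewrite rmorphM /= -!normE normrM. Qed.

Lemma mod1 : mod (1 : C) = 1.
Proof. by rewrite /mod normr1. Qed.

Lemma modX (x : C) k : mod (x ^+ k) = mod x ^+ k.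
Proof. by elim: k => [|k ih]; rewrite ?expr0 ?mod1// !exprS modM ih. Qed.

Lemma modV (x : C) : mod x^-1 = (mod x)^-1.
Proof. by apply: (@complexI R); rewrite fmorphV /= -!normE normfV. Qed.

Lemma mod_nat k : mod (k%:R : C) = k%:R.
Proof. by apply: (@complexI R); rewrite -normE rmorph_nat normr_nat. Qed.

Lemma mod_real (t : R) : mod (t%:C%C : C) = `|t|.
Proof. by rewrite /mod normc_def /= expr0n addr0 sqrtr_sqr. Qed.

Lemma modZ (V : normedModType C) (a : C) (x : V) : mod (a *: x) = mod a * mod x.
Proof. by apply: (@complexI R); rewrite rmorphM /= -!normE normrZ. Qed.

Lemma mod_Re (x : C) : `|complex.Re x| <= mod x.
Proof. by rewrite -lecR -normE normc_ge_Re. Qed.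

Lemma mod_Im (x : C) : `|complex.Im x| <= mod x.
Proof.
case: x => a b; rewrite /mod normc_def /= -[X in X <= _]sqrtr_sqr ler_sqrt ?sqr_ge0//.
  by rewrite lerDr sqr_ge0.
by rewrite addr_ge0 ?sqr_ge0.
Qed.

Lemma mod_ReIm (x : C) : mod x <= `|complex.Re x| + `|complex.Im x|.
Proof.
rewrite [in leLHS](complexE x) (le_trans (modD _ _))// modM !mod_real.
rewrite (_ : mod _ = 1) ?mul1r// /mod normc_def /= expr0n expr1n add0r.
by rewrite sqrtr1.
Qed.

(** Moves convergence to real sequences, where squeezing and linear arithmetic are available. *)
Lemma cvg_mod (V : normedModType C) (u : nat -> V) (l : V) :
  u @ \oo --> l <-> (fun k => mod (u k - l)) @ \oo --> (0 : R).
Proof.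
split.
  move=> /cvgrPdist_lt h; apply/cvgrPdist_lt => e e0.
  have /h : (0 : C) < e%:C%C by rewrite ltcR.
  apply: filterS => k; rewrite normE ltcR sub0r normrN modBC.
  by rewrite ger0_norm ?mod_ge0.
move=> /cvgrPdist_lt h; apply/cvgrPdist_lt => e e0.
have eR : e = (complex.Re e)%:C%C by rewrite RRe_real// gtr0_real.
have /h : 0 < complex.Re e by rewrite -ltcR -eR.
apply: filterS => k; rewrite normE eR ltcR sub0r normrN modBC.
by rewrite ger0_norm ?mod_ge0.
Qed.

Lemma cvg_mod_le (V : normedModType C) (u : nat -> V) (l : V) (b : nat -> R) :
  (forall k, mod (u k - l) <= b k) -> b @ \oo --> (0 : R) -> u @ \oo --> l.
Proof.
move=> ub b0; apply/cvg_mod; apply: (squeeze_cvgr _ (cvg_cst 0) b0).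
by apply: nearW => k; rewrite mod_ge0 ub.
Qed.

Lemma cvg_ReIm (u : nat -> C) (a b : R) :
  (fun k => complex.Re (u k)) @ \oo --> a ->
  (fun k => complex.Im (u k)) @ \oo --> b ->
  u @ \oo --> ((a +i* b)%C : C).
Proof.
move=> ua ub.
apply: (@cvg_mod_le _ _ _ (fun k => `|complex.Re (u k) - a| + `|complex.Im (u k) - b|)).
  move=> k; apply: (le_trans (mod_ReIm _)).
  by case: (u k).
rewrite -[0]addr0; apply: cvgD.
  by apply/norm_cvg0P; rewrite -(subrr a); apply: cvgB => //; exact: cvg_cst.
by apply/norm_cvg0P; rewrite -(subrr b); apply: cvgB => //; exact: cvg_cst.
Qed.

Lemma mod_cvg_le (V : normedModType C) (u : nat -> V) (l : V) (B : R) :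
  u @ \oo --> l -> (\forall k \near \oo, mod (u k) <= B) -> mod l <= B.
Proof.
move=> /cvg_mod ul uB; rewrite -subr_le0.
have : (fun k => mod l - B : R) @ \oo --> mod l - B by exact: cvg_cst.
move=> /ler_cvg_to/(_ ul); apply; near=> k.
have h : mod (u k) <= B by near: k.
have := modBl l (u k); rewrite modBC; lra.
Unshelve. all: by end_near. Qed.

End Modulus.

(** * Geometrically bounded sequences *)

Section GeometricSequences.
Variable R : realType.
Local Notation C := (Cplx R).
Implicit Types (a b : nat -> C) (q M : R).

Lemma geometric_cvg0 M q : 0 <= q < 1 -> (fun k => M * q ^+ k) @ \oo --> (0 : R).
Proof. by move=> /andP[q0 q1]; apply: cvg_geometric; rewrite ger0_norm. Qed.

Lemma geometric_sum_le q m k : 0 <= q < 1 ->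
  \sum_(m <= i < k) q ^+ i <= q ^+ m / (1 - q).
Proof.
move=> /andP[q0 q1]; have q1' : 0 < 1 - q by rewrite subr_gt0.
have [km|/ltnW mk] := leqP k m.
  by rewrite big_geq// divr_ge0 ?exprn_ge0// ltW.
apply: (@le_trans _ _ ((q ^+ m - q ^+ k) / (1 - q))); last first.
  by rewrite ler_pM2r ?invr_gt0// gerBl exprn_ge0.
rewrite -(subnK mk) addnC; elim: (k - m)%N => [|j ih].
  by rewrite addn0 big_geq// subrr mul0r.
rewrite addnS big_nat_recr ?leq_addr//= (le_trans (lerD ih (lexx _)))//.
rewrite exprS le_eqVlt; apply/orP; left; apply/eqP; field.
by rewrite gt_eqF.
Qed.

(** Bernoulli's inequality for [(s / q)^(k+1)], with [s] halfway between [q] and 1. It absorbs every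
    polynomial factor met later (powers of [k], numbers of terms of a Cauchy product) into a
    slightly larger ratio. *)
Lemma nat_mul_geometric q : 0 < q < 1 ->
  exists K s, [/\ 0 <= K, 0 < s < 1 & forall k, k.+1%:R * q ^+ k <= K * s ^+ k].
Proof.
move=> /andP[q0 q1]; pose s := (1 + q) / 2.
have [s0 s1 qs] : [/\ 0 < s, s < 1 & q < s] by rewrite /s; split; lra.
pose e := s / q - 1.
have e0 : 0 < e by rewrite subr_gt0 ltr_pdivlMr// mul1r.
exists (e^-1 * (s / q)), s; split; [|by rewrite s0|].
  apply: mulr_ge0; first by rewrite invr_ge0 ltW.
  by apply: divr_ge0; apply: ltW.
move=> k; have bern : k.+1%:R * e <= (s / q) ^+ k.+1.
  rewrite (_ : s / q = 1 + e); last by rewrite /e; ring.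
  elim: k.+1 => [|j ih]; first by rewrite mul0r expr0.
  have : 1 <= (1 + e) ^+ j by rewrite exprn_ege1// lerDl ltW.
  by rewrite exprS -natr1; nra.
have {}bern : k.+1%:R <= (s / q) ^+ k.+1 / e by rewrite ler_pdivlMr.
rewrite -ler_pdivlMr ?exprn_gt0//; apply: (le_trans bern); rewrite exprS exprMn exprVn le_eqVlt; apply/orP; left.
apply/eqP; field.
by rewrite !gt_eqF ?exprn_gt0.
Qed.

(** Geometric decay is used in place of absolute convergence because it survives multiplication by
    [k^N]. *)
Definition geo a : Prop :=
  exists M q, [/\ 0 <= M, 0 < q < 1 & forall k, mod (a k) <= M * q ^+ k].

Lemma geo_common a b : geo a -> geo b -> exists M q, [/\ 0 <= M, 0 < q < 1,
  forall k, mod (a k) <= M * q ^+ k & forall k, mod (b k) <= M * q ^+ k].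
Proof.
move=> [M [q [M0 /andP[q0 q1] aM]]] [N [s [N0 /andP[s0 s1] bN]]].
exists (M + N), (Num.max q s); split; first by rewrite addr_ge0.
- by rewrite lt_max q0 gt_max q1.
- move=> k; apply: (le_trans (aM k)); apply: ler_pM => //.
  + by rewrite exprn_ge0// ltW.
  + by rewrite lerDl.
  + by rewrite lerXn2r ?nnegrE ?le_max ?lexx ?(ltW q0) ?(ltW s0)// orbT.
- move=> k; apply: (le_trans (bN k)); apply: ler_pM => //.
  + by rewrite exprn_ge0// ltW.
  + by rewrite lerDr.
  + by rewrite lerXn2r ?nnegrE ?le_max ?lexx ?(ltW q0) ?(ltW s0)// orbT.
Qed.

Lemma geo_theta N a : geo a -> geo (fun k => k%:R ^+ N * a k).
Proof.
elim: N => [|N ih] ga.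
  by under eq_fun do rewrite expr0 mul1r.
have [M [q [M0 q01 aM]]] := ih ga.
have [K [s [K0 s01 Ks]]] := nat_mul_geometric q01.
exists (M * K), s; split => //; first by rewrite mulr_ge0.
move=> k; rewrite exprS -mulrA modM mod_nat.
have -> : M * K * s ^+ k = M * (K * s ^+ k) by ring.
apply: le_trans (ler_wpM2l M0 (Ks k)).
rewrite mulrCA ler_pM ?mod_ge0// ler_nat//.
Qed.

Lemma geometric_series_cvg (u : nat -> R) M q : 0 < q < 1 ->
  (forall k, `|u k| <= M * q ^+ k) -> cvgn (series u).
Proof.
move=> /andP[q0 q1] uM; apply: normed_cvg.
apply: (@series_le_cvg _ _ (geometric M q)) => //.
- by move=> k /=.
- by move=> k /=; exact: le_trans (normr_ge0 _) (uM k).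
- by apply: is_cvg_geometric_series; rewrite gtr0_norm.
Qed.

Lemma geo_cvg a : geo a -> cvgn (series a).
Proof.
move=> [M [q [M0 q01 aM]]].
have cr : cvgn (series (fun k => complex.Re (a k))).
  by apply: (geometric_series_cvg q01) => k; apply: le_trans (mod_Re _) (aM k).
have ci : cvgn (series (fun k => complex.Im (a k))).
  by apply: (geometric_series_cvg q01) => k; apply: le_trans (mod_Im _) (aM k).
apply: cvgP; apply: cvg_ReIm.
- rewrite (_ : (fun _ => _) = series (fun k => complex.Re (a k))); first exact: cr.
  apply/funext => k; rewrite /series /=.
  elim: (index_iota 0 k) => [|i r ih]; first by rewrite !big_nil.
  by rewrite !big_cons -ih; case: (a i); case: (\sum_(j <- r) a j).
- rewrite (_ : (fun _ => _) = series (fun k => complex.Im (a k))); first exact: ci.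
  apply/funext => k; rewrite /series /=.
  elim: (index_iota 0 k) => [|i r ih]; first by rewrite !big_nil.
  by rewrite !big_cons -ih; case: (a i); case: (\sum_(j <- r) a j).
Qed.

(* A sealed form of [series a @ \oo --> l], which automation would unfold. *)
Variant psum a (l : C) : Prop := Psum of series a @ \oo --> l.

Lemma psumP a (l : C) : psum a l <-> series a @ \oo --> l.
Proof. by split=> [[]|/Psum]. Qed.

Lemma psum_unique a (l m : C) : psum a l -> psum a m -> l = m.
Proof. by move=> [al] [am]; exact: cvg_unique al am. Qed.

Lemma eq_psum a b (l : C) : a =1 b -> psum a l -> psum b l.
Proof. by move=> /funext ->. Qed.

Lemma psum_lim a : geo a -> psum a (limn (series a)).
Proof. by move=> /geo_cvg/Psum. Qed.

Lemma lim_psum a l : psum a l -> limn (series a) = l.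
Proof. by move=> [al]; exact: cvg_lim al. Qed.

Lemma psumD a b l m : psum a l -> psum b m -> psum (fun k => a k + b k) (l + m).
Proof.
move=> [al] [bm]; apply/Psum; rewrite (_ : series _ = series a \+ series b).
  exact: (cvgD al bm).
by apply/funext => k; rewrite /series /= big_split.
Qed.

Lemma psumZ a l (x : C) : psum a l -> psum (fun k => x * a k) (x * l).
Proof.
move=> [al]; apply/Psum; rewrite (_ : series _ = (fun=> x) \* series a).
  exact: (cvgM (cvg_cst x) al).
by apply/funext => k; rewrite /series /= mulr_sumr.
Qed.

Lemma psum_const0 : psum (fun=> 0) 0.
Proof.
apply/Psum; rewrite (_ : series _ = fun=> 0); first exact: cvg_cst.
by apply/funext => k; rewrite /series /= big1.
Qed.

Lemma psum_sum (I : Type) (r : seq I) (a : I -> nat -> C) (l : I -> C) :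
  (forall i, psum (a i) (l i)) ->
  psum (fun k => \sum_(i <- r) a i k) (\sum_(i <- r) l i).
Proof.
move=> al; elim: r => [|i r ih].
  by under eq_fun do rewrite big_nil; rewrite big_nil; exact: psum_const0.
rewrite big_cons (_ : (fun _ => _) = fun k => a i k + \sum_(j <- r) a j k).
  exact: (psumD (al i) ih).
by apply/funext => k; rewrite big_cons.
Qed.

Lemma psum_finite a p : (forall k, (p <= k)%N -> a k = 0) ->
  psum a (\sum_(0 <= k < p) a k).
Proof.
move=> a0; apply/Psum; apply: cvg_near_cst; exists p => // k /= pk.
rewrite /series /= (@big_cat_nat _ _ _ p)//=.
rewrite (_ : \sum_(p <= i < k) a i = 0) ?addr0//.
by rewrite big_nat_cond big1// => i /andP[/andP[pi _] _]; exact: a0.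
Qed.

Lemma psum_tail a l M q p : 0 <= q < 1 -> (forall k, mod (a k) <= M * q ^+ k) ->
  psum a l -> mod (l - \sum_(0 <= k < p) a k) <= M * q ^+ p / (1 - q).
Proof.
move=> q01 aM [al].
have M0 : 0 <= M by have := aM 0%N; rewrite expr0 mulr1; exact: le_trans (mod_ge0 _).
apply: (@mod_cvg_le _ _ (fun k => series a k - \sum_(0 <= k < p) a k)).
  by apply: (cvgB al); exact: cvg_cst.
exists p => // k /= pk.
rewrite /series /= (@big_cat_nat _ _ _ p)//= addrAC subrr add0r.
apply: (le_trans (mod_sum _ _ _)).
apply: (@le_trans _ _ (\sum_(p <= i < k) M * q ^+ i)); first by apply: ler_sum.
by rewrite -mulr_sumr -mulrA ler_wpM2l// geometric_sum_le.
Qed.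

Definition conv a b (k : nat) : C := \sum_(i < k.+1) a i * b (k - i)%N.

Lemma series_conv a b p :
  series (conv a b) p = \sum_(i < p) a i * series b (p - i)%N.
Proof.
elim: p => [|p ih]; first by rewrite /series /= big_geq// big_ord0.
rewrite -[LHS]/(\sum_(0 <= i < p.+1) conv a b i) big_nat_recr//=.
rewrite -[X in X + _]/(series (conv a b) p) ih.
have serS m : series b m.+1 = series b m + b m.
  by rewrite /series /= big_nat_recr.
have -> : \sum_(i < p) a i * series b (p - i)%N =
          \sum_(i < p.+1) a i * series b (p - i)%N.
  by rewrite big_ord_recr /= subnn /series /= [X in _ * X]big_geq// mulr0 addr0.
rewrite /conv -big_split /=; apply: eq_bigr => i _.
by rewrite -mulrDr subSn -?serS// -ltnS.
Qed.

(** The partial sum of the Cauchy product differs from the product of the partial sums by [p] terms,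
    each a coefficient of [a] times a tail of [b]; their total is at most [M^2 / (1 - q) * p * q^p],
    which tends to 0. *)
Lemma psum_conv a b l m : geo a -> geo b ->
  psum a l -> psum b m -> psum (conv a b) (l * m).
Proof.
move=> ga gb [al] [bm]; have [M [q [M0 q01 aM bM]]] := geo_common ga gb.
have [K [s [K0 s01 Ks]]] := nat_mul_geometric q01.
have q1 : 0 <= q < 1 by case/andP: q01 => /ltW -> ->.
have ab : (series a \* series b) @ \oo --> l * m by exact: (cvgM al bm).
have -> : l * m = l * m + 0 by rewrite addr0.
apply/Psum; rewrite (_ : series _ =
  (series a \* series b) \+ (series (conv a b) \- (series a \* series b))); last first.
  by apply/funext => k /=; ring.
apply: (cvgD ab).
apply: (@cvg_mod_le _ _ _ _ (fun p => (M ^+ 2 / (1 - q) * K) * s ^+ p)); last first.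
  by apply: geometric_cvg0; case/andP: s01 => /ltW -> ->.
move=> p /=; rewrite subr0 series_conv [series a p]/(series _ _) /= big_mkord mulr_suml.
rewrite -sumrB (le_trans (mod_sum _ _ _))//.
have q1' : 0 < 1 - q by case/andP: q1 => _; rewrite subr_gt0.
apply: (@le_trans _ _ (M ^+ 2 / (1 - q) * (p%:R * q ^+ p))); last first.
  rewrite -[leRHS]mulrA ler_wpM2l ?mulr_ge0 ?exprn_ge0 ?invr_ge0 ?(ltW q1')//.
  by apply: le_trans (Ks p); rewrite ler_wpM2r ?exprn_ge0 ?ler_nat// ltW//; case/andP: q01.
rewrite mulrCA mulr_natl -[X in _ *+ X]card_ord -sumr_const.
apply: ler_sum => i _; rewrite -mulrBr modM.
have ip : (p - i <= p)%N by rewrite leq_subr.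
rewrite modBC /series /= (@big_cat_nat _ _ _ (p - i)%N)//= addrAC subrr add0r.
have -> : M ^+ 2 / (1 - q) * q ^+ p = (M * q ^+ i) * (M * (q ^+ (p - i) / (1 - q))).
  have -> : q ^+ p = q ^+ i * q ^+ (p - i) by rewrite -exprD subnKC// ltnW.
  by field; rewrite gt_eqF.
rewrite ler_pM ?mod_ge0// (le_trans (mod_sum _ _ _))//.
apply: (@le_trans _ _ (\sum_(p - i <= j < p) M * q ^+ j)); first exact: ler_sum.
by rewrite -mulr_sumr ler_wpM2l// geometric_sum_le.
Qed.

(* [theta_sum N a] is (z d/dz)^N of the power series with coefficients a,
   evaluated at z = 1. *)
Definition theta_sum (N : nat) a : C := limn (series (fun k => k%:R ^+ N * a k)).

(** Leibniz's rule for [z d/dz]: in the coefficient of index [k] write [k = i + (k - i)] and expand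
    [k^N] by the binomial formula. *)
Lemma theta_sum_conv N a b : geo a -> geo b -> theta_sum N (conv a b) =
  \sum_(l < N.+1) theta_sum (N - l) a * theta_sum l b *+ 'C(N, l).
Proof.
move=> ga gb; apply: lim_psum.
rewrite (_ : (fun _ => _) = fun k => \sum_(l < N.+1) 'C(N, l)%:R *
   conv (fun i => i%:R ^+ (N - l) * a i) (fun i => i%:R ^+ l * b i) k); last first.
  apply/funext => k; under eq_bigr do rewrite /conv mulr_sumr.
  rewrite exchange_big /= /conv mulr_sumr; apply: eq_bigr => i _.
  have {1}-> : k = (i + (k - i))%N by rewrite subnKC// -ltnS.
  rewrite natrD exprDn mulr_suml; apply: eq_bigr => l _.
  by rewrite -[X in X * _]mulr_natl; ring.
under eq_bigr do rewrite -mulr_natl.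
apply: psum_sum => l; apply: psumZ.
by apply: psum_conv; try (by apply: geo_theta); apply: psum_lim; apply: geo_theta.
Qed.

End GeometricSequences.

(** * Power series in one variable *)

Section OneVariable.
Variable R : realType.
Local Notation C := (Cplx R).
Implicit Types (c d : nat -> C) (phi psi : C -> C) (a w z : C) (r s : R).

Lemma psum_bounded (u : nat -> C) (l : C) :
  psum u l -> exists M : R, forall k, mod (u k) <= M.
Proof.
move=> /psumP/cvg_mod /cvgrPdist_le /(_ 1 ltr01) [p _ hp].
pose M := 2 + \sum_(0 <= j < p.+1) mod (u j); exists M => k.
have S0 (m : nat) : 0 <= \sum_(0 <= j < m) mod (u j).
  by apply: sumr_ge0 => i _; exact: mod_ge0.
have [kp|pk] := ltnP k p.+1.
  rewrite /M (@big_cat_nat _ _ _ k)//= ?(ltnW kp)//.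
  rewrite (@big_cat_nat _ _ _ k.+1 k)//= big_nat1.
  have : 0 <= \sum_(k.+1 <= j < p.+1) mod (u j) by apply: sumr_ge0 => i _; exact: mod_ge0.
  have := S0 k; lra.
have h m : (p <= m)%N -> mod (series u m - l) <= 1.
  by move=> /hp /=; rewrite sub0r normrN ger0_norm ?mod_ge0.
have -> : u k = (series u k.+1 - l) - (series u k - l).
  by rewrite /series /= big_nat_recr//=; ring.
apply: (le_trans (modB _ _)).
have := h _ (ltnW pk); have := h k.+1 (leqW (ltnW pk)); have := S0 p.+1.
rewrite /M; lra.
Qed.

Lemma geo_of_bound c w M r : (forall k, mod (c k) * r ^+ k <= M) -> mod w < r ->
  geo (fun k => c k * w ^+ k).
Proof.
move=> cM wr; have r0 : 0 < r by apply: le_lt_trans wr; exact: mod_ge0.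
have M0 : 0 <= M by have := cM 0%N; rewrite expr0 mulr1; exact: le_trans (mod_ge0 _).
have x1 : mod w / r < 1 by rewrite ltr_pdivrMr// mul1r.
have x0 : 0 <= mod w / r by rewrite divr_ge0 ?mod_ge0 ?ltW.
exists M, ((mod w / r + 1) / 2); split => //; first by lra.
move=> k; rewrite modM modX.
apply: (@le_trans _ _ (M * (mod w / r) ^+ k)); last first.
  by rewrite ler_wpM2l// lerXn2r ?nnegrE//; lra.
rewrite expr_div_n mulrCA [leRHS]mulrC ler_wpM2r ?exprn_ge0 ?mod_ge0//.
by rewrite ler_pdivlMr ?exprn_gt0.
Qed.

Lemma geo_of_psum c w z l : psum (fun k => c k * z ^+ k) l -> mod w < mod z ->
  geo (fun k => c k * w ^+ k).
Proof.
move=> /psum_bounded [M hM]; apply: geo_of_bound => k.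
by rewrite -modX -modM.
Qed.

(** Analyticity of one variable is expressed throughout as having some expansion at each point; no
    complex derivative or contour integral appears. *)
Definition expands phi a c : Prop := exists s, 0 < s /\
  forall w, mod w < s -> psum (fun k => c k * w ^+ k) (phi (a + w)).

Lemma geo_of_disc c phi s w :
  (forall w, mod w < s -> psum (fun k => c k * w ^+ k) (phi w)) ->
  mod w < s -> geo (fun k => c k * w ^+ k).
Proof.
move=> h ws; have w0 := mod_ge0 w.
have ht : mod (((mod w + s) / 2)%:C%C : C) = (mod w + s) / 2.
  by rewrite mod_real ger0_norm//; lra.
by apply: (@geo_of_psum _ _ ((mod w + s) / 2)%:C%C); [apply: h|]; rewrite ht; lra.
Qed.

Lemma expands_approx phi a c : expands phi a c -> exists s K : R,
  [/\ 0 < s, 0 <= K & forall w, mod w <= s -> forall p,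
   mod (phi (a + w) - \sum_(0 <= k < p) c k * w ^+ k) <= K * mod w ^+ p / s ^+ p].
Proof.
move=> [s [s0 h]].
have hs : mod ((s / 2)%:C%C : C) = s / 2 by rewrite mod_real ger0_norm//; lra.
have [|M hM] := @psum_bounded (fun k => c k * (s / 2)%:C%C ^+ k) (phi (a + (s / 2)%:C%C)).
  by apply: h; rewrite hs; lra.
have M0 : 0 <= M by apply: le_trans (hM 0%N); exact: mod_ge0.
(* The terms are bounded by [M] at radius [s / 2]. For [mod w <= s / 4] the ratio to that radius is
   at most 1/2, so the tail costs a factor 2. *)
exists (s / 4), (2 * M); split; [lra|lra|] => w ws p.
have w0 := mod_ge0 w.
have x0 : 0 <= mod w / (s / 2) by rewrite divr_ge0//; lra.
have x1 : mod w / (s / 2) <= 2^-1 by rewrite ler_pdivrMr; lra.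
apply: (@le_trans _ _ (M * (mod w / (s / 2)) ^+ p / (1 - mod w / (s / 2)))).
  apply: psum_tail; [lra| |by apply: h; lra].
  move=> k; have := hM k; rewrite !modM !modX hs => hk.
  rewrite (expr_div_n (mod w)) mulrCA [leRHS]mulrC ler_wpM2r ?exprn_ge0//.
  by rewrite ler_pdivlMr// exprn_gt0//; lra.
rewrite ler_pdivrMr; last lra.
have -> : 2 * M * mod w ^+ p / (s / 4) ^+ p = 2 * (M * (mod w / (s / 4)) ^+ p).
  by rewrite (expr_div_n (mod w)) !mulrA.
have h1 : (mod w / (s / 2)) ^+ p <= (mod w / (s / 4)) ^+ p.
  rewrite lerXn2r ?nnegrE//; first by rewrite divr_ge0//; lra.
  by rewrite ler_wpM2l// lef_pV2 ?posrE; lra.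
have h2 := exprn_ge0 p x0.
set A := _ ^+ p in h1 h2 *; set B := _ ^+ p in h1 *; set t := _ / _ in x1 *.
have : M * A <= M * B by rewrite ler_wpM2l.
have : 0 <= M * B by rewrite mulr_ge0//; exact: le_trans h1.
nra.
Qed.

Lemma expands_center phi a c : expands phi a c -> phi a = c 0%N.
Proof.
move=> [s [s0 h]]; have := h 0; rewrite mod0 addr0 => /(_ s0) h0.
apply: (psum_unique h0).
have := @psum_finite R (fun k => c k * 0 ^+ k) 1.
rewrite big_nat1 expr0 mulr1; apply => k k1.
by rewrite expr0n eqn0Ngt k1 mulr0.
Qed.

(** The limit [t -> 0] in elementary form; it isolates a leading coefficient from an error of the
    next order. *)
Lemma le0_linear_small (m L s : R) : 0 < s ->
  (forall t, 0 < t -> t <= s -> m <= L * t) -> m <= 0.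
Proof.
move=> s0 h; rewrite leNgt; apply/negP => m0.
pose t := Num.min s (m / (2 * (`|L| + 1))).
have L0 : 0 < `|L| + 1 by rewrite ltr_wpDl.
have t0 : 0 < t by rewrite lt_min s0 divr_gt0// mulr_gt0.
have ts : t <= s by rewrite ge_min lexx.
have tm : t <= m / (2 * (`|L| + 1)) by rewrite ge_min lexx orbT.
have := h t t0 ts; rewrite leNgt => /negP; apply.
rewrite ler_pdivlMr ?mulr_gt0// in tm.
have := ler_norm L; nra.
Qed.

(** Strong induction on the index: once the earlier coefficients agree, the two Taylor remainders of
    order [p+1] at a real displacement [x] bound [mod (c p - d p) * x^p] by a multiple of
    [x^(p+1)]. *)
Lemma expands_unique phi a c d : expands phi a c -> expands phi a d -> c =1 d.
Proof.
move=> /expands_approx [s [K [s0 K0 hc]]] /expands_approx [t [L [t0 L0 hd]]].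
elim/ltn_ind => p ih; apply/eqP; rewrite -subr_eq0 -mod_eq0 eq_le mod_ge0 andbT.
apply: (@le0_linear_small _ (K / s ^+ p.+1 + L / t ^+ p.+1) (Num.min s t)).
  by rewrite lt_min s0.
move=> x x0; rewrite le_min => /andP[xs xt].
have mx : mod (x%:C%C : C) = x by rewrite mod_real gtr0_norm.
have := hc x%:C%C; have := hd x%:C%C; rewrite mx => /(_ xt p.+1) h1 /(_ xs p.+1) h2.
rewrite -(@ler_pM2r _ (x ^+ p)) ?exprn_gt0//.
rewrite -{1}mx -modX -modM mulrBl.
have -> : c p * x%:C%C ^+ p - d p * x%:C%C ^+ p =
   (phi (a + x%:C%C) - \sum_(0 <= k < p.+1) d k * x%:C%C ^+ k) -
   (phi (a + x%:C%C) - \sum_(0 <= k < p.+1) c k * x%:C%C ^+ k).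
  have -> : \sum_(0 <= k < p.+1) c k * x%:C%C ^+ k =
            \sum_(0 <= k < p) d k * x%:C%C ^+ k + c p * x%:C%C ^+ p.
    by rewrite big_nat_recr//=; congr +%R; apply: eq_big_nat => i /andP[_ /ih ->].
  by rewrite big_nat_recr//=; ring.
apply: (le_trans (modB _ _)); apply: (le_trans (lerD h1 h2)).
rewrite [x ^+ p.+1]exprS le_eqVlt; apply/orP; left; apply/eqP; ring.
Qed.

Lemma expands_cvg phi a c : expands phi a c -> forall e, 0 < e -> exists s, 0 < s /\
  forall w, mod w < s -> mod (phi (a + w) - phi a) < e.
Proof.
move=> hc; have [s [K [s0 K0 h]]] := expands_approx hc.
move=> e e0; exists (Num.min s (e / (K / s + 1))).
have Ks : 0 < K / s + 1 by rewrite ltr_wpDl// divr_ge0// ltW.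
split; first by rewrite lt_min s0 divr_gt0.
move=> w; rewrite lt_min => /andP[/ltW ws we].
have := h w ws 1%N; rewrite big_nat1 expr0 mulr1 -(expands_center hc) !expr1.
move=> /le_lt_trans; apply; rewrite ltr_pdivlMr// in we.
have := mod_ge0 w; rewrite -mulrA [mod w / s]mulrC mulrA; nra.
Qed.

Lemma expandsD phi psi a c d : expands phi a c -> expands psi a d ->
  expands (fun z => phi z + psi z) a (fun k => c k + d k).
Proof.
move=> [s [s0 hc]] [t [t0 hd]]; exists (Num.min s t); split; first by rewrite lt_min s0.
move=> w; rewrite lt_min => /andP[ws wt].
under eq_fun do rewrite mulrDl; apply: psumD; [exact: hc|exact: hd].
Qed.

Lemma expands_cst (x : C) a : expands (fun=> x) a (fun k => if k == 0%N then x else 0).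
Proof.
exists 1; split => // w _.
have := @psum_finite R (fun k => (if k == 0%N then x else 0) * w ^+ k) 1.
rewrite big_nat1 eqxx expr0 mulr1; apply => k k1.
by rewrite eqn0Ngt k1 mul0r.
Qed.

Lemma conv_scale c d w k : conv (fun i => c i * w ^+ i) (fun i => d i * w ^+ i) k =
  conv c d k * w ^+ k.
Proof.
rewrite /conv mulr_suml; apply: eq_bigr => i _.
by rewrite mulrACA -exprD subnKC// -ltnS.
Qed.

Lemma expandsM phi psi a c d : expands phi a c -> expands psi a d ->
  expands (fun z => phi z * psi z) a (conv c d).
Proof.
move=> [s [s0 hc]] [t [t0 hd]]; exists (Num.min s t); split; first by rewrite lt_min s0.
move=> w; rewrite lt_min => /andP[ws wt].
under eq_fun do rewrite -conv_scale.
apply: psum_conv; [| |exact: hc|exact: hd].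
- exact: (@geo_of_disc _ (fun w => phi (a + w)) s).
- exact: (@geo_of_disc _ (fun w => psi (a + w)) t).
Qed.

Lemma expands_sum (I : Type) (r : seq I) (phi : I -> C -> C) a (c : I -> nat -> C) :
  (forall i, expands (phi i) a (c i)) ->
  expands (fun z => \sum_(i <- r) phi i z) a (fun k => \sum_(i <- r) c i k).
Proof.
move=> h; elim: r => [|i r ih].
  exists 1; split => // w _; under eq_fun do rewrite big_nil mul0r; rewrite big_nil.
  exact: psum_const0.
have -> : (fun z => \sum_(j <- i :: r) phi j z) =
          (fun z => phi i z + \sum_(j <- r) phi j z).
  by apply/funext => z; rewrite big_cons.
have -> : (fun k => \sum_(j <- i :: r) c j k) =
          (fun k => c i k + \sum_(j <- r) c j k).
  by apply/funext => k; rewrite big_cons.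
exact: expandsD (h i) ih.
Qed.

Lemma expands_rot phi a c w : mod w = 1 -> expands phi (w * a) c ->
  expands (fun z => phi (w * z)) a (fun k => w ^+ k * c k).
Proof.
move=> w1 [s [s0 h]]; exists s; split => // z zs.
have := h (w * z); rewrite modM w1 mul1r -mulrDr => /(_ zs) hp.
by apply: (eq_psum _ hp) => k; rewrite exprMn mulrCA mulrA.
Qed.

Lemma psum_geometric (q : C) : mod q < 1 -> psum (fun k => q ^+ k) (1 - q)^-1.
Proof.
move=> q1; have q1' : 1 - q != 0.
  by apply: contraTneq q1 => /eqP; rewrite subr_eq0 => /eqP <-; rewrite mod1 ltxx.
apply/Psum; apply: (@cvg_mod_le _ _ _ _ (fun k => mod (1 - q)^-1 * mod q ^+ k)); last first.
  by apply: geometric_cvg0; rewrite mod_ge0.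
move=> k; rewrite -modX -modM.
rewrite (_ : series _ k - _ = - ((1 - q)^-1 * q ^+ k)) ?modN//.
rewrite /series /= big_mkord; apply: (mulfI q1').
have e : (1 - q) * (\sum_(i < k) q ^+ i) = 1 - q ^+ k.
  by rewrite -[1 - q]opprB mulNr -subrX1 opprB.
by rewrite mulrBr e mulrN mulrA divff// mul1r; ring.
Qed.

Lemma expands_inv a : a != 0 ->
  expands (fun z => z^-1) a (fun k => a^-1 * (- a^-1) ^+ k).
Proof.
move=> a0; have ma : 0 < mod a by rewrite lt_def mod_ge0 mod_eq0 a0.
exists (mod a); split => // w wa.
have h : mod (- a^-1 * w) < 1 by rewrite modM modN modV mulrC ltr_pdivrMr// mul1r.
have -> : (a + w)^-1 = a^-1 * (1 - (- a^-1 * w))^-1.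
  by rewrite mulNr opprK -invfM mulrDr mulr1 mulrA divff// mul1r.
by apply: (eq_psum _ (psumZ a^-1 (psum_geometric h))) => k; rewrite exprMn mulrA.
Qed.

(** The local form of the maximum principle. If some coefficient of positive index is nonzero, take
    the first such [c p] and move in a direction where [c p * w^p] is aligned with [c 0]; the
    modulus then grows by [mod (c p) * t^p], up to an error of order [t^(p+1)]. *)
Lemma expands_local phi a c : expands phi a c ->
  (exists s, 0 < s /\ forall w, mod w < s -> phi (a + w) = phi a) \/
  (forall e, 0 < e -> exists w, mod w < e /\ mod (phi a) < mod (phi (a + w))).
Proof.
move=> hc; have [hp|hn] := pselect (exists p, (0 < p)%N && (c p != 0)); last first.
  left; have [s [s0 h]] := hc; exists s; split => // w /h h1.
  rewrite (expands_center hc); apply: (psum_unique h1).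
  have := @psum_finite R (fun k => c k * w ^+ k) 1.
  rewrite big_nat1 expr0 mulr1; apply => k k1.
  have -> : c k = 0 by apply: contrapT => /eqP ck; apply: hn; exists k; rewrite k1.
  by rewrite mul0r.
right => e e0.
case: (ex_minnP hp) => p /andP[p0 cp] pmin {hp}.
have [s [K [s0 K0 h]]] := expands_approx hc.
(* c_p w^p is made to point in the direction of c_0 *)
have [w [w1 cw]] : exists w : C, mod w = 1 /\ forall t : R, 0 < t ->
    mod (c 0%N + c p * (t%:C%C * w) ^+ p) = mod (c 0%N) + mod (c p) * t ^+ p.
  have mt (t : R) : 0 < t -> mod (t%:C%C : C) = t by move=> t0; rewrite mod_real gtr0_norm.
  have [->|c0] := eqVneq (c 0%N) 0.
    exists 1; rewrite mod1; split => // t t0.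
    by rewrite add0r mod0 add0r mulr1 modM modX mt.
  have mc0 : 0 < mod (c 0%N) by rewrite lt_def mod_ge0 mod_eq0 c0.
  have mcp : 0 < mod (c p) by rewrite lt_def mod_ge0 mod_eq0 cp.
  (* [x] has modulus 1 and [c p * x] is a positive multiple of [c 0]; the direction sought is a
     [p]-th root of [x]. *)
  pose x : C := c 0%N / c p * (mod (c p) / mod (c 0%N))%:C%C.
  have x1 : mod x = 1.
    rewrite !modM modV mt ?divr_gt0//; field; by rewrite !gt_eqF.
  exists (p.-root x); split.
    have : mod (p.-root x) ^+ p = 1 by rewrite -modX rootCK// x1.
    by move=> /eqP; rewrite pexpr_eq1 ?mod_ge0// => /eqP.
  move=> t t0; rewrite exprMn rootCK//.
  have -> : c 0%N + c p * (t%:C%C ^+ p * x) =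
      c 0%N * (1 + t ^+ p * (mod (c p) / mod (c 0%N)))%:C%C.
    rewrite rmorphD rmorph1 !rmorphM rmorphXn /= /x rmorphM /= fmorphV /=.
    set y : C := (mod (c 0%N))%:C%C.
    have y0 : y != 0 by rewrite -mod_eq0 mt// gt_eqF.
    have E (A B T y' z : C) : y' != 0 -> B != 0 ->
        A + B * (T * (A / B * (z / y'))) = A * (1 + T * (z / y')).
      by move=> ? ?; field; apply/andP.
    exact: E.
  rewrite modM mod_real ger0_norm; first by field; rewrite gt_eqF.
  by rewrite addr_ge0// mulr_ge0 ?exprn_ge0 ?divr_ge0// ltW.
have mcp : 0 < mod (c p) by rewrite lt_def mod_ge0 mod_eq0 cp.
pose L := K / s ^+ p.+1.
have L0 : 0 <= L by rewrite divr_ge0// exprn_ge0// ltW.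
(* The remainder is at most [L * t * t^p], so it is beaten as soon as [L * t < mod (c p)]; adding 1
   to [L] covers the case [L = 0]. *)
pose t := Num.min (Num.min s (e / 2)) (mod (c p) / (L + 1) / 2).
have t0 : 0 < t by rewrite !lt_min s0 !divr_gt0// ltr_wpDl.
have [ts te tc] : [/\ t <= s, t <= e / 2 & t <= mod (c p) / (L + 1) / 2].
  by rewrite !ge_min !lexx !orbT.
have mt : mod (t%:C%C * w : C) = t by rewrite modM w1 mulr1 mod_real gtr0_norm.
exists (t%:C%C * w); rewrite mt; split; first by lra.
have := h (t%:C%C * w); rewrite mt => /(_ ts p.+1).
rewrite big_nat_recr// (big_ltn p0) big_nat_cond big1 ?addr0; last first.
  move=> i /andP[/andP[i0 ip] _]; have [->|ci] := eqVneq (c i) 0; first by rewrite mul0r.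
  by have := pmin i; rewrite i0 ci => /(_ isT); rewrite leqNgt ip.
rewrite expr0 mulr1 /= => h1.
have h2 := modBl (c 0%N + c p * (t%:C%C * w) ^+ p) (phi (a + t%:C%C * w)).
rewrite modBC cw// in h2.
rewrite (expands_center hc).
have h3 : K * t ^+ p.+1 / s ^+ p.+1 < mod (c p) * t ^+ p.
  have -> : K * t ^+ p.+1 / s ^+ p.+1 = (L * t) * t ^+ p by rewrite /L exprS; ring.
  rewrite ltr_pM2r ?exprn_gt0//.
  have L1 : 0 < L + 1 by lra.
  have {tc} : t * 2 <= mod (c p) / (L + 1) by lra.
  rewrite ler_pdivlMr//; nra.
by rewrite addr0 in h1; lra.
Qed.

End OneVariable.

(** * Maximum principle and expansion on a disc *)

Section MaximumPrinciple.
Variable R : realType.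
Local Notation C := (Cplx R).
Implicit Types (c d : nat -> C) (phi psi : C -> C) (a w z : C) (r s B : R).

(** Compactness of closed discs is obtained in [R * R], from products of segments. *)
Definition of_pair (p : R * R) : C := (p.1 +i* p.2)%C.

Lemma of_pairE z : of_pair (complex.Re z, complex.Im z) = z.
Proof. by case: z. Qed.

Lemma of_pair_dist (p q : R * R) :
  mod (of_pair p - of_pair q) <= `|p.1 - q.1| + `|p.2 - q.2|.
Proof. exact: mod_ReIm. Qed.

Lemma of_pair_near (p : R * R) e : 0 < e ->
  \forall q \near p, mod (of_pair q - of_pair p) < e.
Proof.
move=> e0; have e2 : 0 < e / 2 by rewrite divr_gt0.
near=> q; apply: (le_lt_trans (of_pair_dist _ _)).
have [h1 h2] : ball p (e / 2) q by near: q; exact: nbhsx_ballx.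
by rewrite distrC [`|q.2 - _|]distrC; rewrite -!ball_normE /= in h1 h2; lra.
Unshelve. all: by end_near. Qed.

Lemma continuous_mod_of_pair phi (p : R * R) :
  (forall e, 0 < e -> exists s, 0 < s /\
    forall w, mod w < s -> mod (phi (of_pair p + w) - phi (of_pair p)) < e) ->
  {for p, continuous (fun q => mod (phi (of_pair q)) : R)}.
Proof.
move=> h; apply/cvgrPdist_lt => e /h [s [s0 hs]].
near=> q; have : mod (of_pair q - of_pair p) < s by near: q; exact: of_pair_near.
move=> /hs; rewrite [of_pair p + _]addrC subrK => hq.
rewrite ltr_norml; have := modBl (phi (of_pair q)) (phi (of_pair p)).
have := modBl (phi (of_pair p)) (phi (of_pair q)); rewrite [mod (phi (of_pair p) - _)]modBC.
by move=> *; apply/andP; split; lra.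
Unshelve. all: by end_near. Qed.

Lemma compact_disc r : compact [set p | mod (of_pair p) <= r].
Proof.
apply: (@subclosed_compact _ _ (`[- r, r] `*` `[- r, r])).
- rewrite (_ : mkset _ = (fun q => mod (of_pair q)) @^-1` [set x | x <= r])//.
  apply: preimage_closed; last exact: closed_le.
  move=> p _; apply: (@continuous_mod_of_pair id) => e e0; exists e; split => // w.
  by rewrite /= addrAC subrr add0r.
- by apply: compact_setX; exact: segment_compact.
- move=> p /= h; have := le_trans (mod_Re (of_pair p)) h.
  have := le_trans (mod_Im (of_pair p)) h.
  by rewrite /= !ler_norml !in_itv.
Qed.

(** Two successive maximizations: [mod (phi z)] over the disc, then [mod z] over the compact set of
    maximizers. The second one is what later excludes a function locally constant at an interior
    maximizer. *)
Lemma disc_max phi r : 0 <= r -> (forall z, mod z <= r -> exists c, expands phi z c) ->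
  exists2 z, mod z <= r & (forall w, mod w <= r -> mod (phi w) <= mod (phi z)) /\
   (forall w, mod w <= r -> mod (phi w) = mod (phi z) -> mod w <= mod z).
Proof.
move=> r0 h; pose K := [set p | mod (of_pair p) <= r].
pose F p : R := mod (phi (of_pair p)).
have K0 : K !=set0 by exists (0, 0); rewrite /K /= (_ : of_pair _ = 0)// mod0.
have Fc p : K p -> {for p, continuous F}.
  move=> /h [c hc]; apply: continuous_mod_of_pair; exact: expands_cvg hc.
have [p Kp pmax] : exists2 p, p \in K & forall q, q \in K -> F q <= F p.
  apply: compact_EVT_max => //; first exact: compact_disc.
  by apply: continuous_in_subspaceT => q; rewrite inE; exact: Fc.
pose K' := [set q | K q /\ F q = F p].
have cK' : compact K'.
  apply: (@subclosed_compact _ _ K); [|exact: compact_disc|by move=> q []].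
  rewrite -[K']setCK; apply: open_closedC; rewrite openE => q nK'.
  rewrite /interior; have [Kq|nKq] := pselect (K q).
    have Fq : F q < F p.
      rewrite lt_neqAle pmax ?inE// andbT; apply/eqP => e; exact: nK'.
    have /cvgrPdist_lt/(_ (F p - F q)) := Fc _ Kq; rewrite subr_gt0 => /(_ Fq).
    apply: filterS => t ht [Kt Ft]; move: ht; rewrite Ft distrC.
    by have := ler_norm (F p - F q); lra.
  have e0 : 0 < mod (of_pair q) - r by move: nKq; rewrite /K /= => /negP; rewrite -ltNge; lra.
  have := of_pair_near q e0; apply: filterS => t ht [Kt _].
  have := modBl (of_pair q) (of_pair t); rewrite modBC; rewrite /K /= in Kt; lra.
have [q Kq qmax] : exists2 q, q \in K' & forall t, t \in K' -> mod (of_pair t) <= mod (of_pair q).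
  apply: compact_EVT_max => //; first by exists p; split => //; rewrite inE in Kp.
  apply: continuous_subspaceT => t; apply: (@continuous_mod_of_pair id) => e e0.
  by exists e; split => // w; rewrite /= addrAC subrr add0r.
move: Kq; rewrite inE => -[Kq Fq]; exists (of_pair q) => //.
split=> w wr.
  have := pmax (complex.Re w, complex.Im w); rewrite -Fq inE /K /= of_pairE.
  by move=> /(_ wr); rewrite /F of_pairE.
move=> wq; have := qmax (complex.Re w, complex.Im w).
rewrite inE of_pairE; apply; split; first by rewrite /K /= of_pairE.
by rewrite -Fq /F of_pairE.
Qed.

(** Take a maximizer [a] farthest from 0 and suppose it is interior. By [expands_local] either a
    nearby value has larger modulus, or [phi] is constant near [a], and a small step outwards along
    the ray of [a] reaches a maximizer farther from 0. *)
Lemma maximum_principle phi r B : 0 < r ->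
  (forall z, mod z <= r -> exists c, expands phi z c) ->
  (forall z, mod z = r -> mod (phi z) <= B) ->
  forall z, mod z <= r -> mod (phi z) <= B.
Proof.
move=> r0 h hB z zr; have [a ar [amax afar]] := disc_max (ltW r0) h.
apply: (le_trans (amax z zr)).
have [arr|arr] := eqVneq (mod a) r; first exact: hB.
have {arr ar} ar : mod a < r by rewrite lt_neqAle arr.
have [c hc] := h a (ltW ar).
have [[s [s0 hs]]|hbig] := expands_local hc; last first.
  have /hbig [w [ws]] : 0 < r - mod a by rewrite subr_gt0.
  by rewrite ltNge amax// (le_trans (modD _ _))//; lra.
pose t := Num.min (s / 2) (r - mod a).
have t0 : 0 < t by rewrite lt_min divr_gt0// subr_gt0.
have [ts tr] : t <= s / 2 /\ t <= r - mod a by rewrite !ge_min !lexx orbT.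
have mt : mod (t%:C%C : C) = t by rewrite mod_real gtr0_norm.
have [w mw aw] : exists2 w, mod w = t & mod (a + w) = mod a + t.
  have [->|a0] := eqVneq a 0; first by exists t%:C%C; rewrite ?add0r ?mod0 ?add0r.
  have ma : 0 < mod a by rewrite lt_def mod_ge0 mod_eq0 a0.
  exists (a * (t / mod a)%:C%C).
    by rewrite modM mod_real ger0_norm; [field; rewrite gt_eqF|rewrite divr_ge0// ltW].
  have -> : a + a * (t / mod a)%:C%C = a * (1 + t / mod a)%:C%C.
    by rewrite rmorphD rmorph1 mulrDr mulr1.
  rewrite modM mod_real ger0_norm; first by field; rewrite gt_eqF.
  by rewrite addr_ge0// divr_ge0// ltW.
have := afar (a + w); rewrite aw => /(_ ltac:(lra)).
rewrite hs ?mw; last by lra.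
by move=> /(_ erefl); lra.
Qed.

(** The value at 0 is a parameter; the first-order coefficient of [phi] at 0 makes the singularity
    removable. *)
Definition diff_quot phi (x : C) : C -> C :=
  fun z => if z == 0 then x else (phi z - phi 0) / z.

Lemma diff_quotE phi (x : C) z : phi z = phi 0 + z * diff_quot phi x z.
Proof.
rewrite /diff_quot; case: eqVneq => [->|z0]; first by rewrite mul0r addr0.
by rewrite mulrCA divff// mulr1 addrC subrK.
Qed.

Lemma expands_near phi psi a c s : 0 < s ->
  (forall w, mod w < s -> phi (a + w) = psi (a + w)) -> expands phi a c -> expands psi a c.
Proof.
move=> s0 e [t [t0 ht]]; exists (Num.min s t); split; first by rewrite lt_min s0.
by move=> w; rewrite lt_min => /andP[ws wt]; rewrite -e//; exact: ht.
Qed.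

Lemma expands_diff_quot0 phi c : expands phi 0 c ->
  expands (diff_quot phi (c 1%N)) 0 (fun k => c k.+1).
Proof.
move=> hc; have [s [s0 hs]] := hc; exists s; split => // w ws; rewrite add0r /diff_quot.
case: eqVneq => [->|w0].
  have := @psum_finite R (fun k => c k.+1 * 0 ^+ k) 1.
  rewrite big_nat1 expr0 mulr1; apply => k k1.
  by rewrite expr0n eqn0Ngt k1 mulr0.
have := hs w ws; rewrite add0r (expands_center hc) => /psumP hw.
have {hw} hw : (fun k => w^-1 * (series (fun k => c k * w ^+ k) k.+1 - c 0%N)) @ \oo -->
    w^-1 * (phi w - c 0%N).
  apply: (cvgM (cvg_cst _)); apply: (cvgB _ (cvg_cst _)).
  by rewrite (cvg_shiftS (series (fun k => c k * w ^+ k))).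
apply/Psum; rewrite mulrC (_ : series _ = fun k => w^-1 * (series (fun k => c k * w ^+ k) k.+1 - c 0%N))//.
apply/funext => k; rewrite /series /= big_nat_recl// expr0 mulr1 addrAC subrr add0r.
by rewrite mulr_sumr; apply: eq_bigr => i _; rewrite exprS; field.
Qed.

Lemma expands_diff_quot phi (x : C) a c : a != 0 -> expands phi a c ->
  exists d, expands (diff_quot phi x) a d.
Proof.
move=> a0 hc; have ma : 0 < mod a by rewrite lt_def mod_ge0 mod_eq0 a0.
eexists; apply: (@expands_near (fun z => (phi z + - phi 0) * z^-1) _ _ _ (mod a)) => //.
  move=> w wa; rewrite /diff_quot; case: eqVneq => // /eqP.
  by rewrite addr_eq0 => /eqP e; move: wa; rewrite e modN ltxx.
apply: expandsM (expands_inv a0); apply: expandsD hc (expands_cst _ _).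
Qed.

(** Iterated difference quotients at 0. The gain over the local expansion is that [psi] is analytic
    on the whole closed disc, so that the maximum principle applies to it. *)
Lemma taylor_remainder phi r c m :
  (forall z, mod z <= r -> exists c, expands phi z c) -> expands phi 0 c ->
  exists psi, [/\ forall z, mod z <= r -> exists c, expands psi z c,
    expands psi 0 (fun k => c (k + m)%N) &
    forall z, phi z = \sum_(0 <= k < m) c k * z ^+ k + z ^+ m * psi z].
Proof.
elim: m phi c => [|m ih] phi c h hc.
  exists phi; split => //; first by under eq_fun do rewrite addn0.
  by move=> z; rewrite big_geq// add0r mul1r.
have hQ z : mod z <= r -> exists d, expands (diff_quot phi (c 1%N)) z d.
  move=> zr; have [->|z0] := eqVneq z 0.
    by exists (fun k => c k.+1); exact: expands_diff_quot0.
  by have [d hd] := h z zr; exact: expands_diff_quot hd.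
have [psi [h1 h2 h3]] := ih _ _ hQ (expands_diff_quot0 hc); exists psi; split.
- exact: h1.
- by under eq_fun do rewrite addnS.
- move=> z; rewrite (diff_quotE _ (c 1%N)) h3 (expands_center hc) big_nat_recl//.
  rewrite expr0 mulr1 -addrA mulrDr; congr (_ + (_ + _)); last by rewrite exprS mulrA.
  by rewrite mulr_sumr; apply: eq_bigr => i _; rewrite exprS mulrCA.
Qed.

Lemma exists_prim_root n : (0 < n)%N -> exists w : C, n.-primitive_root w.
Proof.
move=> n_gt0; have [r Dp] := closed_field_poly_normal ('X^n - 1 : {poly C}).
move: Dp; rewrite (monicP _) ?monicXnsubC// scale1r => Dp.
have rn1 : all n.-unity_root r.
  by apply/allP => z; rewrite -root_prod_XsubC -Dp.
have sz_r : (n < (size r).+1)%N by rewrite -(size_prod_XsubC r id) -Dp size_XnsubC.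
have [|w] := hasP (has_prim_root n_gt0 rn1 _ sz_r); last by exists w.
rewrite -separable_prod_XsubC -Dp; apply: separable_Xn_sub_1.
by rewrite pnatr_eq0 -lt0n.
Qed.

(* The average of w^j phi(w^j z) over the n-th roots of unity w^j kills every
   coefficient before the one of index n-1, so that dividing by z^(n-1) leaves
   an analytic function with value c_(n-1) at 0. *)
Lemma cauchy_estimate phi r B c : 0 < r ->
  (forall z, mod z <= r -> exists c, expands phi z c) ->
  (forall z, mod z = r -> mod (phi z) <= B) -> expands phi 0 c ->
  forall k, mod (c k) * r ^+ k <= B.
Proof.
move=> r0 h hB hc k; have [w wp] := exists_prim_root (ltn0Sn k).
have w1 : mod w = 1.
  have : mod w ^+ k.+1 = 1 by rewrite -modX (prim_expr_order wp) mod1.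
  by move=> /eqP; rewrite pexpr_eq1 ?mod_ge0// => /eqP.
have wj1 j : mod (w ^+ j) = 1 by rewrite modX w1 expr1n.
have k0 : (k.+1%:R : C) != 0 by rewrite pnatr_eq0.
pose f (j : nat) z := (k.+1%:R^-1 * w ^+ j) * phi (w ^+ j * z).
have fexp j z d : expands phi (w ^+ j * z) d ->
   expands (f j) z (fun i => (k.+1%:R^-1 * w ^+ j) * ((w ^+ j) ^+ i * d i)).
  move=> /(expands_rot (wj1 j)) [s [s0 hs]]; exists s; split => // x xs.
  have := psumZ (k.+1%:R^-1 * w ^+ j) (hs x xs); apply: eq_psum => i.
  by rewrite -!mulrA.
pose G z := \sum_(0 <= j < k.+1) f j z.
have hG z : mod z <= r -> exists c, expands G z c.
  move=> zr; have /choice [d hd] : forall j, exists d, expands phi (w ^+ j * z) d.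
    by move=> j; apply: h; rewrite modM wj1 mul1r.
  by eexists; apply: expands_sum => j; apply: fexp; exact: hd.
have hG0 : expands G 0 (fun i => \sum_(0 <= j < k.+1)
    (k.+1%:R^-1 * w ^+ j) * ((w ^+ j) ^+ i * c i)).
  by apply: expands_sum => j; apply: fexp; rewrite mulr0.
set cG := (fun _ => _) in hG0.
have cGE i : cG i = k.+1%:R^-1 * c i * (\sum_(j < k.+1) (w ^+ i.+1) ^+ j).
  rewrite /cG big_mkord mulr_sumr; apply: eq_bigr => j _.
  by rewrite -!exprM mulSn exprD [(j * i)%N]mulnC; ring.
have cG0 i : (i < k)%N -> cG i = 0.
  move=> ik; have wi : w ^+ i.+1 - 1 != 0.
    by rewrite subr_eq0 -(prim_order_dvd wp) gtnNdvd.
  rewrite cGE (_ : \sum_(j < _) _ = 0) ?mulr0//; apply: (mulfI wi).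
  by rewrite -subrX1 mulr0 exprAC (prim_expr_order wp) expr1n subrr.
have cGk : cG k = c k.
  rewrite cGE (prim_expr_order wp) (eq_bigr (fun=> 1)); last by move=> j _; rewrite expr1n.
  by rewrite sumr_const card_ord -mulr_natl mulr1 mulrAC mulVf// mul1r.
have [psi [p1 p2 p3]] := taylor_remainder k hG hG0.
(* [psi] takes the value [c k] at 0. As the coefficients of [G] below index [k] vanish,
   [G z = z^k * psi z], and on the circle of radius [r] the average [G] is bounded by [B] like
   [phi]. *)
rewrite -cGk -[k in cG k]add0n -(expands_center p2) -ler_pdivlMr ?exprn_gt0//.
apply: (maximum_principle r0 p1) => [z zr|]; last by rewrite mod0 ltW.
rewrite ler_pdivlMr ?exprn_gt0// -zr -modX -modM mulrC.
have := p3 z; rewrite big_nat_cond big1 ?add0r; last first.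
  by move=> i /andP[/andP[_ /cG0 ->] _]; rewrite mul0r.
move=> <-; apply: (le_trans (mod_sum _ _ _)).
apply: (@le_trans _ _ (\sum_(0 <= j < k.+1) k.+1%:R^-1 * B)).
  apply: ler_sum => j _; rewrite !modM wj1 mulr1 modV mod_nat ler_wpM2l ?invr_ge0//.
  by apply: hB; rewrite modM wj1 mul1r.
by rewrite big_mkord sumr_const card_ord -[leLHS]mulr_natl mulrA divff ?mul1r// pnatr_eq0.
Qed.

(** Write the remainder of order [m] as [z^m * psi z]. On a circle of radius [r] between [mod z] and
    [rho], Cauchy's estimates bound [psi] by [(m+1) * B / r^m]; the maximum principle carries this
    bound to [z], and [(m+1) * (mod z / r)^m] tends to 0. *)
Theorem disc_expansion phi rho c :
  (forall z, mod z < rho -> exists c, expands phi z c) -> expands phi 0 c ->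
  forall z, mod z < rho -> psum (fun k => c k * z ^+ k) (phi z).
Proof.
move=> h hc z zrho; pose r := (mod z + rho) / 2; have z0 := mod_ge0 z.
have [r0 zr rrho] : [/\ 0 < r, mod z < r & r < rho] by rewrite /r; split; lra.
have hr w : mod w <= r -> exists c, expands phi w c by move=> wr; apply: h; lra.
have [x _ [xmax _]] := disc_max (ltW r0) hr; set B := mod (phi x) in xmax.
have hB w : mod w = r -> mod (phi w) <= B by move=> wr; apply: xmax; rewrite wr.
have B0 : 0 <= B := mod_ge0 _.
have cB := cauchy_estimate r0 hr hB hc.
have q01 : 0 < (mod z / r + 1) / 2 < 1.
  have : mod z / r < 1 by rewrite ltr_pdivrMr// mul1r.
  have : 0 <= mod z / r by rewrite divr_ge0// ltW.
  by move=> *; apply/andP; split; lra.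
have [K [s [K0 s01 Ks]]] := nat_mul_geometric q01.
apply/Psum; apply: (@cvg_mod_le _ _ _ _ (fun m => B * K * s ^+ m)); last first.
  by apply: geometric_cvg0; case/andP: s01 => /ltW -> ->.
move=> m; have [psi [p1 p2 p3]] := taylor_remainder m hr hc.
have -> : series (fun k => c k * z ^+ k) m - phi z = - (z ^+ m * psi z).
  by rewrite p3 /series /=; ring.
rewrite modN modM modX.
have hpsi : mod (psi z) <= m.+1%:R * B / r ^+ m.
  apply: (maximum_principle r0 p1) => [w wr|]; last exact: ltW.
  rewrite ler_pdivlMr ?exprn_gt0// -wr -modX -modM mulrC.
  have -> : w ^+ m * psi w = phi w - \sum_(0 <= k < m) c k * w ^+ k by rewrite p3; ring.
  apply: (le_trans (modB _ _)); rewrite -natr1 mulrDl mul1r addrC lerD ?hB//.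
  apply: (le_trans (mod_sum _ _ _)).
  apply: (@le_trans _ _ (\sum_(0 <= k < m) B)).
    by apply: ler_sum => k _; rewrite modM modX wr.
  by rewrite big_mkord sumr_const card_ord mulr_natl.
apply: (le_trans (ler_wpM2l (exprn_ge0 _ z0) hpsi)).
have -> : mod z ^+ m * (m.+1%:R * B / r ^+ m) = B * (m.+1%:R * (mod z / r) ^+ m).
  by rewrite (expr_div_n (mod z)); move: (mod z ^+ m) (r ^+ m)^-1 => ? ?; ring.
rewrite -[leRHS]mulrA ler_wpM2l//; apply: le_trans (Ks m).
have x1 : mod z / r < 1 by rewrite ltr_pdivrMr// mul1r.
have x0 : 0 <= mod z / r by rewrite divr_ge0// ltW.
by rewrite ler_wpM2l// lerXn2r ?nnegrE//; lra.
Qed.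

End MaximumPrinciple.

(** * Homogeneous polynomials *)

Section HomogeneousParts.
Variables (R : realType) (n : nat).
Local Notation C := (Cplx R).
Implicit Types (c d : ('I_n -> nat) -> C) (w : 'rV[C]_n) (t s M : R).

(** The sum of moduli is submultiplicative on products of homogeneous polynomials and controls
    values on polydiscs, which suits products and reciprocals of series. *)
Definition coef_norm c (k : nat) : R :=
  \sum_(alpha : {ffun 'I_n -> 'I_k.+1} | (\sum_i alpha i == k)%N)
    mod (c (fun i => alpha i)).

Lemma coef_norm_ge0 c k : 0 <= coef_norm c k.
Proof. by apply: sumr_ge0 => alpha _; exact: mod_ge0. Qed.

Lemma mod_monomial_le (alpha : 'I_n -> nat) w t : (forall i, mod (w 0 i) <= t) ->
  mod (monomial alpha w) <= t ^+ (\sum_i alpha i)%N.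
Proof.
move=> wt; rewrite /monomial -prodrXr; elim/big_ind2 : _ => [||i _].
- by rewrite mod1.
- by move=> x1 x2 y1 y2 h1 h2; rewrite modM ler_pM ?mod_ge0.
- by rewrite modX lerXn2r ?nnegrE ?mod_ge0// (le_trans _ (wt i))// mod_ge0.
Qed.

Lemma abs_hpartE c k w : abs_hpart c k w =
  (\sum_(alpha : {ffun 'I_n -> 'I_k.+1} | (\sum_i alpha i == k)%N)
    mod (c (fun i => alpha i) * monomial (fun i => alpha i) w))%:C%C.
Proof.
by rewrite /abs_hpart rmorph_sum; apply: eq_bigr => alpha _; rewrite normE.
Qed.

Lemma mod_abs_hpart_le c k w t : (forall i, mod (w 0 i) <= t) ->
  mod (abs_hpart c k w) <= coef_norm c k * t ^+ k.
Proof.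
move=> wt; rewrite abs_hpartE mod_real ger0_norm; last first.
  by apply: sumr_ge0 => alpha _; exact: mod_ge0.
rewrite mulr_suml; apply: ler_sum => alpha /eqP ak; rewrite modM ler_wpM2l ?mod_ge0//.
by apply: le_trans (mod_monomial_le _ wt) _; rewrite ak.
Qed.

Lemma mod_hpart_le c k w t : (forall i, mod (w 0 i) <= t) ->
  mod (hpart c k w) <= coef_norm c k * t ^+ k.
Proof.
move=> wt; apply: le_trans (mod_abs_hpart_le c k wt).
rewrite abs_hpartE mod_real; apply: le_trans (ler_norm _); exact: mod_sum.
Qed.

(** On the diagonal every monomial of degree [k] has the same value, so absolute convergence at this
    single point bounds all coefficients. *)
Lemma abs_hpart_const c k t : 0 <= t ->
  abs_hpart c k (const_mx t%:C%C) = (coef_norm c k * t ^+ k)%:C%C.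
Proof.
move=> t0; rewrite abs_hpartE mulr_suml; congr (_ %:C)%C; apply: eq_bigr => alpha /eqP ak.
rewrite modM; congr (_ * _); rewrite /monomial.
under eq_bigr do rewrite mxE.
by rewrite prodrXr ak modX mod_real ger0_norm.
Qed.

Lemma hpartZ c k (x : C) w : hpart c k (x *: w) = x ^+ k * hpart c k w.
Proof.
rewrite /hpart mulr_sumr; apply: eq_bigr => alpha /eqP ak.
rewrite mulrCA; congr (_ * _); rewrite /monomial -[in RHS](congr1 (GRing.exp x) ak).
rewrite -prodrXr -big_split /=; by apply: eq_bigr => i _; rewrite mxE exprMn.
Qed.

Lemma geo_hpart c w M s t : 0 < t -> t < s -> (forall k, coef_norm c k * s ^+ k <= M) ->
  (forall i, mod (w 0 i) <= t) -> geo (fun k => hpart c k w).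
Proof.
move=> t0 ts cM wt; have s0 := lt_trans t0 ts.
exists M, (t / s); split.
- by apply: le_trans (cM 0%N); rewrite expr0 mulr1 coef_norm_ge0.
- by rewrite divr_gt0//= ltr_pdivrMr// mul1r.
- move=> k; apply: (le_trans (mod_hpart_le c k wt)).
  rewrite expr_div_n mulrA [leRHS]mulrAC ler_wpM2r ?exprn_ge0 ?(ltW t0)//.
  by rewrite ler_pdivlMr ?exprn_gt0.
Qed.

(* [P] is a homogeneous polynomial of degree [k] whose coefficients have sum of
   moduli at most [B]. *)
Definition homogeneous (k : nat) (P : 'rV[C]_n -> C) (B : R) : Prop :=
  exists c, (forall w, hpart c k w = P w) /\ coef_norm c k <= B.

(** The exponents [A j] may repeat, as they do after multiplying out a product; terms with equal
    exponents are collected, which can only lower the sum of moduli. *)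
Lemma homogeneous_monomials k (J : finType) (p : pred J) (b : J -> C)
    (A : J -> 'I_n -> nat) : (forall j, p j -> (\sum_i A j i)%N = k) ->
  homogeneous k (fun w => \sum_(j | p j) b j * monomial (A j) w)
    (\sum_(j | p j) mod (b j)).
Proof.
move=> Ak.
have Alt j i : p j -> (A j i < k.+1)%N.
  by move=> /Ak <-; rewrite ltnS (bigD1 i)//= leq_addr.
pose al j : {ffun 'I_n -> 'I_k.+1} := [ffun i => inord (A j i)].
have alE j i : p j -> al j i = A j i :> nat.
  by move=> pj; rewrite ffunE inordK// Alt.
have alk j : p j -> (\sum_i al j i == k)%N.
  by move=> pj; rewrite (eq_bigr (A j)) ?Ak// => i _; rewrite alE.
have alP j (alpha : {ffun 'I_n -> 'I_k.+1}) : p j ->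
    [forall i, A j i == alpha i] = (al j == alpha).
  move=> pj; apply/forallP/eqP => [h|<- i]; last by rewrite alE.
  by apply/ffunP => i; apply/val_inj; rewrite /= alE//; exact/eqP.
pose c := fun alpha : 'I_n -> nat => \sum_(j | p j && [forall i, A j i == alpha i]) b j.
have cE (alpha : {ffun 'I_n -> 'I_k.+1}) :
    c (fun i => alpha i) = \sum_(j | p j && (al j == alpha)) b j.
  by apply: eq_bigl => j; case pj : (p j) => //=; exact: alP.
exists c; split.
  move=> w; rewrite [RHS](partition_big al (fun alpha => (\sum_i alpha i == k)%N) alk) /hpart.
  apply: eq_bigr => alpha _; rewrite cE mulr_suml; apply: eq_bigr => j /andP[pj /eqP <-].
  by congr (_ * monomial _ _); apply/funext => i; rewrite alE.
rewrite [leRHS](partition_big al (fun alpha => (\sum_i alpha i == k)%N) alk); apply: ler_sum => alpha _.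
by rewrite cE mod_sum.
Qed.

Lemma homogeneousW k P (B D : R) : B <= D -> homogeneous k P B -> homogeneous k P D.
Proof. by move=> BD [c [cP cB]]; exists c; split => //; exact: le_trans BD. Qed.

Lemma homogeneousM k l P Q (B D : R) : homogeneous k P B -> homogeneous l Q D ->
  homogeneous (k + l) (fun w => P w * Q w) (B * D).
Proof.
move=> [c [cP cB]] [d [dQ dD]].
have := @homogeneous_monomials (k + l)
  ({ffun 'I_n -> 'I_k.+1} * {ffun 'I_n -> 'I_l.+1})%type
  (fun j => (\sum_i j.1 i == k)%N && (\sum_i j.2 i == l)%N)
  (fun j => c (fun i => j.1 i) * d (fun i => j.2 i)) (fun j i => (j.1 i + j.2 i)%N).
have -> : (fun w => P w * Q w) = (fun w =>
   \sum_(j : {ffun 'I_n -> 'I_k.+1} * {ffun 'I_n -> 'I_l.+1} |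
        (\sum_i j.1 i == k)%N && (\sum_i j.2 i == l)%N)
     c (fun i => j.1 i) * d (fun i => j.2 i) * monomial (fun i => (j.1 i + j.2 i)%N) w).
  apply/funext => w; rewrite -cP -dQ /hpart big_distrlr /= pair_big /=.
  apply: eq_bigr => j _; rewrite mulrACA; congr (_ * _).
  by rewrite /monomial -big_split /=; apply: eq_bigr => i _; rewrite exprD.
move=> /(_ _)/homogeneousW; apply.
- apply: le_trans (ler_pM (coef_norm_ge0 _ _) (coef_norm_ge0 _ _) cB dD).
  rewrite /coef_norm big_distrlr /= pair_big /= le_eqVlt; apply/orP; left; apply/eqP.
  by apply: eq_bigr => j _; rewrite modM.
- by move=> j /andP[/eqP j1 /eqP j2]; rewrite big_split /= j1 j2.
Qed.

Lemma homogeneousZ k P (B : R) (x : C) : homogeneous k P B ->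
  homogeneous k (fun w => x * P w) (mod x * B).
Proof.
move=> [c [cP cB]]; exists (fun alpha => x * c alpha); split.
  by move=> w; rewrite -cP /hpart mulr_sumr; apply: eq_bigr => alpha _; rewrite mulrA.
apply: le_trans (ler_wpM2l (mod_ge0 x) cB).
by rewrite /coef_norm mulr_sumr ler_sum// => alpha _; rewrite modM.
Qed.

Lemma homogeneousD k P Q (B D : R) : homogeneous k P B -> homogeneous k Q D ->
  homogeneous k (fun w => P w + Q w) (B + D).
Proof.
move=> [c [cP cB]] [d [dQ dD]]; exists (fun alpha => c alpha + d alpha); split.
  move=> w; rewrite -cP -dQ /hpart -big_split.
  by apply: eq_bigr => alpha _; rewrite mulrDl.
apply: le_trans (lerD cB dD).
by rewrite /coef_norm -big_split ler_sum// => alpha _; exact: modD.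
Qed.

Lemma homogeneous0 k : homogeneous k (fun=> 0) 0.
Proof.
exists (fun=> 0); split; last by rewrite /coef_norm big1// => alpha _; rewrite mod0.
by move=> w; rewrite /hpart big1// => alpha _; rewrite mul0r.
Qed.

Lemma homogeneous_sum k (I : Type) (r : seq I) (P : I -> 'rV[C]_n -> C) (B : I -> R) :
  (forall i, homogeneous k (P i) (B i)) ->
  homogeneous k (fun w => \sum_(i <- r) P i w) (\sum_(i <- r) B i).
Proof.
move=> h; elim: r => [|i r ih].
  under eq_fun do rewrite big_nil.
  by rewrite big_nil; exact: homogeneous0.
under eq_fun do rewrite big_cons.
by rewrite big_cons; exact: homogeneousD.
Qed.

Lemma homogeneous_cst (x : C) : homogeneous 0 (fun=> x) (mod x).
Proof.
have := @homogeneous_monomials 0 unit predT (fun=> x) (fun _ _ => 0%N).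
have -> : (fun w => \sum_(j : unit) x * monomial (fun=> 0%N) w) = (fun=> x).
  apply/funext => w; rewrite (big_pred1 tt)/=; last by case.
  by rewrite /monomial big1 ?mulr1// => i _; rewrite expr0.
rewrite (big_pred1 tt)/=; last by case.
by apply => _ _; rewrite big1.
Qed.

Lemma homogeneous_hpart c k : homogeneous k (hpart c k) (coef_norm c k).
Proof. by exists c. Qed.

(** The total degree of a multi-index tells which polynomial its coefficient comes from, so separate
    choices for each [k] merge into one coefficient function. *)
Lemma homogeneous_series (P : nat -> 'rV[C]_n -> C) (B : nat -> R) :
  (forall k, homogeneous k (P k) (B k)) ->
  exists c, forall k, (forall w, hpart c k w = P k w) /\ coef_norm c k <= B k.
Proof.
move=> /choice [c hc]; exists (fun alpha => c (\sum_i alpha i)%N alpha) => k.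
have [h1 h2] := hc k; split.
- by move=> w; rewrite -h1; apply: eq_bigr => alpha /eqP {1}->.
- by apply: le_trans h2; apply: ler_sum => alpha /eqP {1}->.
Qed.

End HomogeneousParts.

(** * Local power series in several variables *)

Section Analytic.
Variables (R : realType) (n : nat).
Local Notation C := (Cplx R).
Local Notation B := (Bn R n).
Implicit Types (c d : ('I_n -> nat) -> C) (w : 'rV[C]_n) (f g : B -> C) (a z : B).
Implicit Types (r s t M : R).

Definition sqn w : R := \sum_i mod (w 0 i) ^+ 2.

Lemma sqnE w : \sum_i `|w 0 i| ^+ 2 = (sqn w)%:C%C.
Proof. by rewrite rmorph_sum; apply: eq_bigr => i _; rewrite normE rmorphXn. Qed.

Lemma sqn_ge0 w : 0 <= sqn w.
Proof. by apply: sumr_ge0 => i _; rewrite exprn_ge0// mod_ge0. Qed.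

Lemma BnE w : (w \in B) = (sqn w < 1).
Proof.
apply/idP/idP; first by rewrite inE /Bn /= sqnE -[1]/(1%:C)%C ltcR.
by rewrite inE /Bn /= sqnE -[1 in X in _ -> X]/(1%:C)%C ltcR.
Qed.

Lemma sqn_Bn z : sqn (val z) < 1.
Proof. by rewrite -BnE; exact: valP. Qed.

Lemma sqn_coord w i t : 0 <= t -> sqn w < t ^+ 2 -> mod (w 0 i) < t.
Proof.
move=> t0 h; rewrite -(@ltr_pXn2r _ 2) ?nnegrE ?mod_ge0//; apply: le_lt_trans h.
by rewrite /sqn (bigD1 i)//= lerDl sumr_ge0// => j _; rewrite exprn_ge0 ?mod_ge0.
Qed.

Lemma sqn_lt w s : 0 < s -> (forall i, mod (w 0 i) < s) -> sqn w <= n%:R * s ^+ 2.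
Proof.
move=> s0 ws; rewrite mulr_natl -[X in _ *+ X]card_ord -sumr_const.
by apply: ler_sum => i _; rewrite lerXn2r ?nnegrE ?mod_ge0 ?ltW.
Qed.

Lemma coord_Bn z i : mod (val z 0 i) < 1.
Proof. by apply: sqn_coord => //; rewrite expr1n sqn_Bn. Qed.

(** A polydisc version of local analyticity with an explicit coefficient bound, the form that sums,
    products and reciprocals preserve. *)
Definition lexpands f a c : Prop := exists s M, [/\ 0 < s,
  forall k, coef_norm c k * s ^+ k <= M &
  forall z, (forall i, mod ((val z - val a) 0 i) < s) ->
    psum (fun k => hpart c k (val z - val a)) (f z)].

Lemma translate_Bn a t : 0 < t -> t <= 1 -> 3 * n%:R * t < 1 - sqn (val a) ->
  val a + const_mx t%:C%C \in B.
Proof.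
move=> t0 t1 ht; rewrite BnE.
(* The factor 3 comes from [(|a_i| + t)^2 <= |a_i|^2 + 3 t], valid as [|a_i| < 1] and [t <= 1]. *)
suff : sqn (val a + const_mx t%:C%C) <= sqn (val a) + n%:R * (3 * t) by lra.
rewrite mulr_natl -[X in _ *+ X]card_ord -sumr_const -big_split /=.
apply: ler_sum => i _; rewrite !mxE.
have h1 := modD (val a 0 i) t%:C%C; rewrite mod_real gtr0_norm// in h1.
have h2 := coord_Bn a i; have h3 := mod_ge0 (val a 0 i).
apply: (@le_trans _ _ ((mod (val a 0 i) + t) ^+ 2)).
  by rewrite lerXn2r ?nnegrE ?mod_ge0// addr_ge0// ltW.
have : t * mod (val a 0 i) <= t * 1 by rewrite ler_wpM2l ?ltW.
have : t * t <= t * 1 by rewrite ler_wpM2l// ltW.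
nra.
Qed.

(** From left to right, absolute convergence at the point [a + (t, ..., t)] bounds all coefficients;
    from right to left, halving the radius turns the coefficient bound into absolute convergence. *)
Lemma analyticP f : analytic f <-> forall a, exists c, lexpands f a c.
Proof.
split=> h a; last first.
  have [c [s [M [s0 cM hc]]]] := h a; exists (s / 2), c.
  have s2 : 0 < s / 2 by rewrite divr_gt0.
  split => // z; rewrite sqnE ltcR => hz.
  have zs i : mod ((val z - val a) 0 i) < s / 2 by apply: sqn_coord hz; exact: ltW.
  split; last by apply/psumP; apply: hc => i; apply: (lt_trans (zs i)); lra.
  apply: geo_cvg; exists M, 2^-1; split.
  - by apply: le_trans (cM 0%N); rewrite expr0 mulr1 coef_norm_ge0.
  - by apply/andP; split; lra.
  - move=> k; apply: (le_trans (mod_abs_hpart_le c k (fun i => ltW (zs i)))).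
    by rewrite expr_div_n mulrA exprVn ler_wpM2r// invr_ge0 exprn_ge0.
have [r [c [r0 hc]]] := h a; exists c.
have sa := sqn_Bn a.
have n3 : 0 < 3 * n%:R + 1 :> R by rewrite ltr_wpDl// mulr_ge0.
have n1 : 0 < n%:R + 1 :> R by rewrite ltr_wpDl.
(* The first two bounds keep [a + (t, ..., t)] in the unit ball, the third puts the polydisc of
   radius [t] inside the ball of radius [r]. *)
pose t := Num.min (Num.min 1 ((1 - sqn (val a)) / (3 * n%:R + 1))) (r / (n%:R + 1)).
have t0 : 0 < t by rewrite !lt_min ltr01 !divr_gt0// subr_gt0.
have [t1 t2 t3] : [/\ t <= 1, t <= (1 - sqn (val a)) / (3 * n%:R + 1) & t <= r / (n%:R + 1)].
  by rewrite !ge_min !lexx !orbT.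
rewrite ler_pdivlMr// in t2; rewrite ler_pdivlMr// in t3.
have ntr : n%:R * t ^+ 2 < r ^+ 2.
  have : (t * (n%:R + 1)) ^+ 2 <= r ^+ 2 by rewrite lerXn2r ?nnegrE// ?mulr_ge0// ltW.
  have n0 : 0 <= n%:R :> R by [].
  have := exprn_gt0 2 t0; rewrite exprMn; nra.
have cB : val a + const_mx t%:C%C \in B by apply: translate_Bn => //; lra.
have [|cv _] := hc (exist (fun w : 'rV[C]_n => w \in B) _ cB).
  rewrite /= addrAC subrr add0r sqnE ltcR; apply: le_lt_trans ntr.
  rewrite /sqn mulr_natl -[X in _ *+ X]card_ord -sumr_const; apply: ler_sum => i _.
  by rewrite mxE mod_real gtr0_norm.
rewrite /= addrAC subrr add0r in cv.
move: cv => /Psum/psum_bounded[M hM].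
exists t, M; split => // [k|z zt].
  by have := hM k; rewrite (abs_hpart_const _ _ (ltW t0)) mod_real; apply: le_trans; exact: ler_norm.
by apply/Psum; apply: (proj2 (hc z _)); rewrite sqnE ltcR; apply: le_lt_trans ntr; exact: sqn_lt.
Qed.

Lemma lexpands_center f a c : lexpands f a c -> forall w, hpart c 0 w = f a.
Proof.
move=> [s [M [s0 cM hc]]] w.
have h0 : hpart c 0 w = hpart c 0 (0 : 'rV_n).
  by rewrite -(scale0r w) hpartZ expr0 mul1r.
have ha : psum (fun k => hpart c k (0 : 'rV_n)) (f a).
  by have := hc a; rewrite subrr; apply => i; rewrite mxE mod0.
rewrite h0; apply/esym/(psum_unique ha).
have := @psum_finite R (fun k => hpart c k (0 : 'rV_n)) 1.
rewrite big_nat1; apply => k k1.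
by rewrite -(scale0r (0 : 'rV_n)) hpartZ expr0n eqn0Ngt k1 mul0r.
Qed.

Lemma analytic_cst (x : C) : analytic (fun _ : B => x).
Proof.
apply/analyticP => a; pose P k w : C := if k == 0%N then x else 0.
have [k|c hc] := @homogeneous_series R n P (fun k => if k == 0%N then mod x else 0).
  case: k => [|k]; [exact: homogeneous_cst|exact: homogeneous0].
exists c; exists 1, (mod x); split => // [k|z _].
  rewrite expr1n mulr1; apply: (le_trans (proj2 (hc k))).
  by case: ifP => // _; exact: mod_ge0.
have := @psum_finite R (fun k => P k (val z - val a)) 1.
rewrite big_nat1; move=> hp; have {}hp := hp _; apply: eq_psum (hp _) => [k|k k1].
  by rewrite (proj1 (hc k)).
by rewrite /P eqn0Ngt k1.
Qed.

Lemma lexpands_common f g a c d : lexpands f a c -> lexpands g a d ->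
  exists s M, [/\ 0 < s, 0 <= M, forall k, coef_norm c k * s ^+ k <= M,
   forall k, coef_norm d k * s ^+ k <= M &
   forall z, (forall i, mod ((val z - val a) 0 i) < s) ->
    psum (fun k => hpart c k (val z - val a)) (f z) /\
    psum (fun k => hpart d k (val z - val a)) (g z)].
Proof.
move=> [s [M [s0 cM hc]]] [t [N [t0 dN hd]]].
have M0 : 0 <= M by apply: le_trans (cM 0%N); rewrite expr0 mulr1 coef_norm_ge0.
have N0 : 0 <= N by apply: le_trans (dN 0%N); rewrite expr0 mulr1 coef_norm_ge0.
have st0 : 0 < Num.min s t by rewrite lt_min s0.
exists (Num.min s t), (M + N); split => //.
- by rewrite addr_ge0.
- move=> k; apply: (@le_trans _ _ M); last by rewrite lerDl.
  apply: le_trans (cM k); rewrite ler_wpM2l ?coef_norm_ge0// lerXn2r ?nnegrE ?(ltW st0) ?(ltW s0)//.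
  by rewrite ge_min lexx.
- move=> k; apply: (@le_trans _ _ N); last by rewrite lerDr.
  apply: le_trans (dN k); rewrite ler_wpM2l ?coef_norm_ge0// lerXn2r ?nnegrE ?(ltW st0) ?(ltW t0)//.
  by rewrite ge_min lexx orbT.
- move=> z h; split; [apply: hc => i|apply: hd => i]; have := h i; rewrite lt_min.
    by case/andP.
  by case/andP.
Qed.

Lemma analyticD f g : analytic f -> analytic g -> analytic (fun z => f z + g z).
Proof.
move=> /analyticP hf /analyticP hg; apply/analyticP => a.
have [c hc] := hf a; have [d hd] := hg a.
have [s [M [s0 M0 cM dM h]]] := lexpands_common hc hd.
have [k|e he] := @homogeneous_series R n (fun k w => hpart c k w + hpart d k w)
    (fun k => coef_norm c k + coef_norm d k).
  by apply: homogeneousD; exact: homogeneous_hpart.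
exists e, s, (M + M); split => // [k|z zs].
  apply: le_trans (lerD (cM k) (dM k)); rewrite -mulrDl ler_wpM2r ?exprn_ge0 ?(ltW s0)//.
  by have [] := he k.
have [h1 h2] := h z zs; apply: eq_psum (psumD h1 h2) => k.
by rewrite (proj1 (he k)).
Qed.

(** The product has [k+1] terms in degree [k]; halving the radius provides a factor [2^-k] that
    absorbs this number. *)
Lemma analyticM f g : analytic f -> analytic g -> analytic (fun z => f z * g z).
Proof.
move=> /analyticP hf /analyticP hg; apply/analyticP => a.
have [c hc] := hf a; have [d hd] := hg a.
have [s [M [s0 M0 cM dM h]]] := lexpands_common hc hd.
have [k|e he] := @homogeneous_series R n
    (fun k w => conv (fun i => hpart c i w) (fun i => hpart d i w) k)
    (fun k => \sum_(i < k.+1) coef_norm c i * coef_norm d (k - i)%N).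
  apply: homogeneous_sum => i.
  have := homogeneousM (homogeneous_hpart c i) (homogeneous_hpart d (k - i)).
  by rewrite subnKC// -ltnS.
have [K [q [K0 q01 Kq]]] : exists K q : R, [/\ 0 <= K, 0 < q < 1 &
    forall k, k.+1%:R * 2^-1 ^+ k <= K * q ^+ k].
  by apply: nat_mul_geometric; apply/andP; split; lra.
have s2 : 0 < s / 2 by rewrite divr_gt0.
exists e, (s / 2), (M ^+ 2 * K); split => // [k|z zs].
  apply: le_trans (ler_wpM2r (exprn_ge0 _ (ltW s2)) (proj2 (he k))) _.
  apply: (@le_trans _ _ (M ^+ 2 * (k.+1%:R * 2^-1 ^+ k))); last first.
    rewrite ler_wpM2l ?exprn_ge0//; apply: (le_trans (Kq k)).
    have /andP[q0 q1] := q01; have := exprn_ile1 k (ltW q0) (ltW q1).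
    by nra.
  rewrite mulr_suml [leRHS]mulrCA [leRHS]mulr_natl -[X in _ <= _ *+ X]card_ord -sumr_const.
  apply: ler_sum => i _; have ik : (i <= k)%N by rewrite -ltnS.
  have -> : (s / 2) ^+ k = s ^+ i * s ^+ (k - i) * 2^-1 ^+ k.
    by rewrite -exprD subnKC// exprMn.
  rewrite mulrA ler_wpM2r ?exprn_ge0// mulrACA expr2.
  by rewrite ler_pM// mulr_ge0 ?coef_norm_ge0 ?exprn_ge0// ltW.
have zs' i : mod ((val z - val a) 0 i) < s by apply: (lt_trans (zs i)); lra.
have [h1 h2] := h z zs'.
have gc : geo (fun k => hpart c k (val z - val a)).
  by apply: (@geo_hpart _ _ _ _ M s (s / 2)) => // [|i]; [lra|exact: ltW].
have gd : geo (fun k => hpart d k (val z - val a)).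
  by apply: (@geo_hpart _ _ _ _ M s (s / 2)) => // [|i]; [lra|exact: ltW].
by apply: eq_psum (psum_conv gc gd h1 h2) => k; rewrite (proj1 (he k)).
Qed.

Lemma analyticX f m : analytic f -> analytic (fun z => f z ^+ m).
Proof.
move=> hf; elim: m => [|m ih].
  by under eq_fun do rewrite expr0; exact: analytic_cst.
by under eq_fun do rewrite exprS; exact: analyticM.
Qed.

(* [inv_fuel p m k] is the coefficient of index [k] of the reciprocal of the
   power series [p], whenever [k < m]. *)
Fixpoint inv_fuel (p : nat -> C) (m k : nat) : C :=
  if m is m'.+1 then
    if k is k'.+1 then
      - (p 0%N)^-1 * \sum_(i < k'.+1) p i.+1 * inv_fuel p m' (k' - i)
    else (p 0%N)^-1
  else 0.

Definition inv_coef p k := inv_fuel p k.+1 k.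

Lemma inv_fuelE p m k : (k < m)%N -> inv_fuel p m k = inv_coef p k.
Proof.
rewrite /inv_coef; elim/ltn_ind : k m => -[|k] ih [|m] km //.
have fE i : (i <= k)%N -> inv_fuel p m i = inv_fuel p k.+1 i.
  move=> ik; rewrite (ih i) ?(ih i _ k.+1) ?ltnS// (leq_ltn_trans ik)//.
rewrite -[RHS]/(- (p 0%N)^-1 * \sum_(i < k.+1) p i.+1 * inv_fuel p k.+1 (k - i)) /=.
by congr (_ * _); apply: eq_bigr => i _; rewrite fE ?leq_subr.
Qed.

Lemma inv_coefS p k : inv_coef p k.+1 =
  - (p 0%N)^-1 * \sum_(i < k.+1) p i.+1 * inv_coef p (k - i).
Proof.
rewrite /inv_coef -[LHS]/(- (p 0%N)^-1 * \sum_(i < k.+1) p i.+1 * inv_fuel p k.+1 (k - i)).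
by congr (_ * _); apply: eq_bigr => i _; rewrite inv_fuelE// ltnS leq_subr.
Qed.

Lemma conv_inv_coef p k : p 0%N != 0 -> conv p (inv_coef p) k = (k == 0%N)%:R.
Proof.
move=> p0; case: k => [|k]; first by rewrite /conv big_ord1 mulfV.
rewrite /conv big_ord_recl subn0 inv_coefS mulrA mulrN mulfV// mulN1r.
by under [X in _ + X]eq_bigr do rewrite lift0 subSS; rewrite addNr.
Qed.

(** The reciprocal recursion, run on homogeneous parts, stays within homogeneous polynomials. A
    geometric bound on their coefficients gives convergence to some [l], and the Cauchy product with
    the series of [f] shows [f z * l = 1]. *)
Lemma analyticV f : (forall z, f z != 0) -> analytic f -> analytic (fun z => (f z)^-1).
Proof.
move=> f0 /analyticP hf; apply/analyticP => a.
have [c hc0] := hf a; have cz := lexpands_center hc0.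
have [s [M [s0 cM hc]]] := hc0.
have M0 : 0 <= M by apply: le_trans (cM 0%N); rewrite expr0 mulr1 coef_norm_ge0.
set m := mod (f a); have m0 : 0 < m by rewrite lt_def mod_ge0 mod_eq0 f0.
pose N := M + 1; have N0 : 0 < N by rewrite ltr_wpDl.
(* Chosen so that [x / (1 - x) = m / N]: with [t = s * x], the geometric sum in the recursion then
   reproduces exactly the bound [m^-1 / t^k]. *)
pose x := m / (m + N); have mN : 0 < m + N by rewrite addr_gt0.
have x0 : 0 < x by rewrite divr_gt0.
have x1 : x < 1 by rewrite ltr_pdivrMr// mul1r ltrDl.
pose t := s * x; have t0 : 0 < t by rewrite mulr_gt0.
pose e k w := inv_coef (fun i => hpart c i w) k.
have he k : homogeneous k (e k) (m^-1 / t ^+ k).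
  elim/ltn_ind : k => -[_|k ih].
    rewrite expr0 divr1 /m -modV.
    have -> : e 0%N = (fun=> (f a)^-1) by apply/funext => w; rewrite /e /inv_coef /= cz.
    exact: homogeneous_cst.
  have -> : e k.+1 = (fun w => - (f a)^-1 * \sum_(i < k.+1) hpart c i.+1 w * e (k - i)%N w).
    by apply/funext => w; rewrite /e inv_coefS cz.
  have := @homogeneousZ R n k.+1 (fun w => \sum_(i < k.+1) hpart c i.+1 w * e (k - i)%N w)
    (\sum_(i < k.+1) (N / s ^+ i.+1) * (m^-1 / t ^+ (k - i))) (- (f a)^-1).
  move=> /(_ _)/homogeneousW; apply; last first.
    apply: homogeneous_sum => i.
    have ik : (i <= k)%N by rewrite -ltnS.
    rewrite -[in X in homogeneous X](subnKC ik) -addSn; apply: homogeneousM.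
      apply: homogeneousW (homogeneous_hpart c i.+1).
      by rewrite ler_pdivlMr ?exprn_gt0// (le_trans (cM _))// lerDl ler01.
    by apply: ih; rewrite ltnS leq_subr.
  rewrite modN modV -/m.
  have -> : \sum_(i < k.+1) (N / s ^+ i.+1) * (m^-1 / t ^+ (k - i)) =
      N * m^-1 / t ^+ k.+1 * (x * \sum_(0 <= i < k.+1) x ^+ i).
    rewrite big_mkord !mulr_sumr; apply: eq_bigr => i _.
    have ik : (i <= k)%N by rewrite -ltnS.
    have -> : t ^+ k.+1 = t ^+ i.+1 * t ^+ (k - i) by rewrite -exprD addSn subnKC.
    have -> : t ^+ i.+1 = s ^+ i.+1 * x ^+ i.+1 by rewrite exprMn.
    rewrite [x ^+ i.+1]exprS.
    have xi : x ^+ i != 0 by rewrite expf_neq0// gt_eqF.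
    have si : s ^+ i.+1 != 0 by rewrite expf_neq0// gt_eqF.
    have ti : t ^+ (k - i) != 0 by rewrite expf_neq0// gt_eqF.
    move: (x ^+ i) (s ^+ i.+1) (t ^+ (k - i)) xi si ti => X S T xi si ti.
    by field; rewrite xi si ti !gt_eqF.
  have := @geometric_sum_le R x 0 k.+1; rewrite (ltW x0) x1 expr0 => /(_ isT) hx.
  have tk : 0 < t ^+ k.+1 by rewrite exprn_gt0.
  have : x * (\sum_(0 <= i < k.+1) x ^+ i) <= m / N.
    apply: (le_trans (ler_wpM2l (ltW x0) hx)); rewrite le_eqVlt; apply/orP; left; apply/eqP.
    by rewrite /x; field; rewrite !gt_eqF//= addrAC subrr add0r gt_eqF.
  have N' : 0 <= m^-1 * (N * m^-1 / t ^+ k.+1).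
    by rewrite !mulr_ge0 ?invr_ge0 ?ltW.
  move=> /(ler_wpM2l N'); rewrite mulrA => /le_trans; apply.
  rewrite le_eqVlt; apply/orP; left; apply/eqP.
  by move: (t ^+ k.+1) tk => T T0; field; rewrite !gt_eqF.
have [d hd] := homogeneous_series he.
have dM k : coef_norm d k * t ^+ k <= m^-1.
  by rewrite -ler_pdivlMr ?exprn_gt0//; have [] := hd k.
have t2 : 0 < t / 2 by rewrite divr_gt0.
exists d, (t / 2), m^-1; split => // [k|z zs].
  apply: le_trans (dM k); rewrite ler_wpM2l ?coef_norm_ge0// lerXn2r ?nnegrE ?ltW//.
  by lra.
have ts : t <= s by rewrite /t -[leRHS]mulr1 ler_wpM2l// ltW.
have hz : psum (fun k => hpart c k (val z - val a)) (f z).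
  by apply: hc => i; apply: (lt_trans (zs i)); lra.
have gc : geo (fun k => hpart c k (val z - val a)).
  by apply: (@geo_hpart _ _ _ _ M s (t / 2)) => // [|i]; [lra|exact: ltW].
have gd : geo (fun k => hpart d k (val z - val a)).
  by apply: (@geo_hpart _ _ _ _ m^-1 t (t / 2)) => // [|i]; [lra|exact: ltW].
have hl := psum_lim gd; set l := limn _ in hl.
have : psum (fun k => (k == 0%N)%:R : C) (f z * l).
  apply: eq_psum (psum_conv gc gd hz hl) => k.
  rewrite (_ : (fun k => hpart d k _) = inv_coef (fun k => hpart c k (val z - val a))).
    by rewrite conv_inv_coef// cz.
  by apply/funext => i; rewrite (proj1 (hd i)).
move/psum_unique => /(_ 1) h1.
have <- : l = (f z)^-1; last exact: hl.
apply: (mulfI (f0 z)); rewrite mulfV// h1//.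
have := @psum_finite R (fun k => (k == 0%N)%:R : C) 1; rewrite big_nat1; apply.
by move=> k k1; rewrite eqn0Ngt k1.
Qed.

End Analytic.

(** * Homogeneous expansion on the ball *)

Section HomogeneousExpansion.
Variables (R : realType) (n : nat).
Local Notation C := (Cplx R).
Local Notation B := (Bn R n).
Implicit Types (c d : ('I_n -> nat) -> C) (w : 'rV[C]_n) (f g : B -> C) (a z : B).

(** [insubd] sends points outside the ball to the centre, so the definition is meaningful only where
    [x *: val z] lies in the ball. *)
Definition slice f z (x : C) : C := f (insubd (Bn_center R n) (x *: val z)).

Lemma sqnZ (x : C) w : sqn (x *: w) = mod x ^+ 2 * sqn w.
Proof. by rewrite mulr_sumr; apply: eq_bigr => i _; rewrite mxE modM exprMn. Qed.

(** A radius larger than 1 is required because the slice returns [f z] at [x = 1], which has to lie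
    strictly inside the disc. *)
Lemma exists_radius z : exists rho : R, 1 < rho /\
  forall x : C, mod x < rho -> x *: val z \in B.
Proof.
have := sqn_Bn z; have := sqn_ge0 (val z); set q := sqn _ => q0 q1.
exists (1 + (1 - q) / 4); split; first by lra.
move=> x xr; rewrite BnE sqnZ -/q.
have x0 := mod_ge0 x.
have : mod x ^+ 2 <= (1 + (1 - q) / 4) ^+ 2 by rewrite lerXn2r ?nnegrE//; lra.
move=> h; apply: (@le_lt_trans _ _ ((1 + (1 - q) / 4) ^+ 2 * q)).
  by rewrite ler_wpM2r.
by nra.
Qed.

Lemma slice1 f z : slice f z 1 = f z.
Proof. by rewrite /slice scale1r; congr f; apply/val_inj; rewrite val_insubd (valP z : val z \in B). Qed.

(** Displacements along the line are multiples [w *: val z], so homogeneity turns the local series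
    in several variables into a power series in [w]. *)
Lemma expands_slice f z (x : C) (rho : R) c : (forall x : C, mod x < rho -> x *: val z \in B) ->
  mod x < rho -> lexpands f (insubd (Bn_center R n) (x *: val z)) c ->
  expands (slice f z) x (fun k => hpart c k (val z)).
Proof.
move=> hrho xr [s [M [s0 cM hc]]].
exists (Num.min s (rho - mod x)); split; first by rewrite lt_min s0 subr_gt0.
move=> w; rewrite lt_min => /andP[ws wr].
have xw : mod (x + w) < rho by apply: (le_lt_trans (modD _ _)); lra.
have e : val (insubd (Bn_center R n) ((x + w) *: val z)) -
         val (insubd (Bn_center R n) (x *: val z)) = w *: val z.
  by rewrite !val_insubd !hrho// scalerDl addrAC subrr add0r.
have := hc (insubd (Bn_center R n) ((x + w) *: val z)); rewrite e => h.
apply: eq_psum (h _) => [k|i]; first by rewrite hpartZ mulrC.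
rewrite mxE modM; apply: le_lt_trans ws; rewrite -[leRHS]mulr1.
by rewrite ler_wpM2l ?mod_ge0// ltW// coord_Bn.
Qed.

Lemma analytic_slice f z (rho : R) : analytic f ->
  (forall x : C, mod x < rho -> x *: val z \in B) ->
  forall x : C, mod x < rho -> exists d : nat -> C, expands (slice f z) x d.
Proof.
move=> /analyticP hf hrho x xr; have [c hc] := hf (insubd (Bn_center R n) (x *: val z)).
by exists (fun k => hpart c k (val z)); exact: (expands_slice hrho xr hc).
Qed.

Lemma analytic_expansion f : analytic f -> exists c, forall z : B,
  psum (fun k => hpart c k (val z)) (f z).
Proof.
move=> hf; have [c hc] := proj1 (analyticP f) hf (Bn_center R n); exists c => z.
have [rho [rho1 hrho]] := exists_radius z.
have h0 : expands (slice f z) 0 (fun k => hpart c k (val z)).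
  apply: (expands_slice hrho); first by rewrite mod0; lra.
  rewrite scale0r (_ : insubd _ _ = Bn_center R n)//.
  by apply/val_inj; rewrite val_insubd Bn_0.
have := disc_expansion (analytic_slice hf hrho) h0 (z := 1); rewrite mod1 slice1 => /(_ rho1).
by apply: eq_psum => k; rewrite expr1n mulr1.
Qed.

Definition taylor_part f z (k : nat) : C := hpart (taylor_coef f) k (val z).

Lemma taylor_partP f z : analytic f -> psum (taylor_part f z) (f z).
Proof.
move=> /analytic_expansion [c hc]; apply/psumP; rewrite /taylor_part /taylor_coef.
case: xgetP => [x _|/(_ c)]; first exact.
by case=> y; apply/psumP; exact: hc.
Qed.

Lemma taylor_part_slice f z (rho : R) (x : C) : analytic f ->
  (forall x : C, mod x < rho -> x *: val z \in B) -> mod x < rho ->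
  psum (fun k => taylor_part f z k * x ^+ k) (slice f z x).
Proof.
move=> hf hrho xr; have := taylor_partP (insubd (Bn_center R n) (x *: val z)) hf.
by apply: eq_psum => k; rewrite /taylor_part val_insubd hrho// hpartZ mulrC.
Qed.

Lemma taylor_part_expands f z : analytic f -> expands (slice f z) 0 (taylor_part f z).
Proof.
move=> hf; have [rho [rho1 hrho]] := exists_radius z.
exists rho; split; first by lra.
by move=> w wr; rewrite add0r; exact: taylor_part_slice hrho wr.
Qed.

(** [taylor_coef] is an arbitrary choice, but on each line through 0 the uniqueness of one-variable
    expansions determines the homogeneous parts. This is how the parts of sums and products are
    computed. *)
Lemma taylor_part_unique f z (c : nat -> C) : analytic f ->
  expands (slice f z) 0 c -> taylor_part f z = c.
Proof.
by move=> hf hc; apply/funext; exact: expands_unique (taylor_part_expands z hf) hc.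
Qed.

Lemma geo_taylor_part f z : analytic f -> geo (taylor_part f z).
Proof.
move=> hf; have [rho [rho1 hrho]] := exists_radius z.
have := @geo_of_disc _ (taylor_part f z) (slice f z) rho 1 _.
rewrite mod1 => /(_ _ rho1); under eq_fun do rewrite expr1n mulr1.
by apply => w wr; exact: taylor_part_slice hrho wr.
Qed.

(** Unlike [radial], this keeps the term [k = 0]. That changes only the case [N = 0], where it gives
    back [f z], as Leibniz's rule requires. *)
Definition theta_at (N : nat) f z : C := theta_sum N (taylor_part f z).

Lemma radialE N f z : (0 < N)%N -> radial N f z = theta_at N f z.
Proof.
move=> N0; rewrite /radial /theta_at /theta_sum; congr (lim (_ @ \oo)).
apply/funext => -[|m]; first by rewrite /series /= !big_geq.
by rewrite /series /= [RHS]big_ltn// expr0n eqn0Ngt N0 mul0r add0r.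
Qed.

Lemma theta_at0 f z : analytic f -> theta_at 0 f z = f z.
Proof.
move=> hf; apply: lim_psum; apply: eq_psum (taylor_partP z hf) => k.
by rewrite expr0 mul1r.
Qed.

Lemma theta_atM N f g z : analytic f -> analytic g ->
  theta_at N (fun z => f z * g z) z =
  \sum_(l < N.+1) theta_at (N - l) f z * theta_at l g z *+ 'C(N, l).
Proof.
move=> hf hg; rewrite /theta_at (taylor_part_unique (analyticM hf hg)
  (expandsM (taylor_part_expands z hf) (taylor_part_expands z hg))).
by rewrite theta_sum_conv//; exact: geo_taylor_part.
Qed.

Lemma theta_atD N f g z : analytic f -> analytic g ->
  theta_at N (fun z => f z + g z) z = theta_at N f z + theta_at N g z.
Proof.
move=> hf hg; rewrite /theta_at (taylor_part_unique (analyticD hf hg)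
  (expandsD (taylor_part_expands z hf) (taylor_part_expands z hg))).
apply: lim_psum.
have := psumD (psum_lim (geo_theta N (geo_taylor_part z hf)))
  (psum_lim (geo_theta N (geo_taylor_part z hg))).
by apply: eq_psum => k; rewrite mulrDr.
Qed.

Lemma theta_at_cst N (x : C) z : theta_at N (fun=> x) z = if N == 0%N then x else 0.
Proof.
case: N => [|N]; first by rewrite theta_at0//; exact: analytic_cst.
rewrite /theta_at (taylor_part_unique (analytic_cst x) (expands_cst x 0)).
apply: lim_psum; apply: eq_psum (psum_const0 R) => k.
by case: eqP => [->|_]; rewrite ?mulr0// expr0n mul0r.
Qed.

Lemma theta_atZ N (x : C) f z : analytic f ->
  theta_at N (fun z => x * f z) z = x * theta_at N f z.
Proof.
move=> hf; rewrite (theta_atM _ _ (analytic_cst x) hf) big_ord_recr /=.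
rewrite big1 ?add0r; last first.
  move=> i _; rewrite theta_at_cst subn_eq0 leqNgt (ltn_ord i) /=.
  by rewrite mul0r mul0rn.
by rewrite subnn theta_at_cst eqxx binn.
Qed.

Lemma analytic_sum (I : Type) (r : seq I) (f : I -> B -> C) :
  (forall i, analytic (f i)) -> analytic (fun z => \sum_(i <- r) f i z).
Proof.
move=> hf; elim: r => [|i r ih].
  by under eq_fun do rewrite big_nil; exact: analytic_cst.
have -> : (fun z => \sum_(j <- i :: r) f j z) = (fun z => f i z + \sum_(j <- r) f j z).
  by apply/funext => z; rewrite big_cons.
exact: (analyticD (hf i) ih).
Qed.

Lemma theta_at_sum (I : Type) (r : seq I) N (f : I -> B -> C) z :
  (forall i, analytic (f i)) ->
  theta_at N (fun z => \sum_(i <- r) f i z) z = \sum_(i <- r) theta_at N (f i) z.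
Proof.
move=> hf; elim: r => [|i r ih].
  under eq_fun do rewrite big_nil.
  by rewrite big_nil theta_at_cst; case: ifP.
have -> : (fun z => \sum_(j <- i :: r) f j z) = (fun z => f i z + \sum_(j <- r) f j z).
  by apply/funext => y; rewrite big_cons.
by rewrite big_cons (theta_atD N z (hf i) (analytic_sum r hf)) ih.
Qed.

(** Split off one factor [f] by Leibniz's rule. The term with no derivative on that factor contains
    [f z = 0]; in the others fewer than [N] derivatives fall on [f^m * g], and induction applies. *)
Lemma theta_at_vanish m N f g z : analytic f -> analytic g -> f z = 0 -> (N < m)%N ->
  theta_at N (fun z => f z ^+ m * g z) z = 0.
Proof.
move=> hf hg fz; elim: m N => // m ih N Nm.
have -> : (fun z => f z ^+ m.+1 * g z) = (fun z => f z * (f z ^+ m * g z)).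
  by apply/funext => y; rewrite exprS mulrA.
rewrite (theta_atM N z hf (analyticM (analyticX m hf) hg)).
rewrite big1// => l _; have [lN|lN] := eqVneq (l : nat) N.
  by rewrite lN subnn theta_at0// fz mul0r mul0rn.
rewrite ih ?mulr0 ?mul0rn//; apply: leq_trans (_ : N <= m)%N => //.
by rewrite ltn_neqAle lN -ltnS ltn_ord.
Qed.

(* With V = f z, (V - f)^(N+1) g vanishes to order N+1 at z, so that R^N kills
   it there; expand the binomial and take g = h / f. *)
Lemma radial_div N f h z : (0 < N)%N -> analytic f -> analytic h -> (forall z, f z != 0) ->
  radial N (fun z => (f z)^-1 * h z) z =
  \sum_(j < N.+1) ((-1) ^+ j * 'C(N.+1, j.+1)%:R) *
     ((f z)^-1 ^+ j.+1 * radial N (fun z => f z ^+ j * h z) z).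
Proof.
move=> N0 hf hh f0; have hV := analyticV f0 hf; have hg := analyticM hV hh.
set g := fun z => (f z)^-1 * h z in hg *; set V := f z.
have hVf : analytic (fun z => V + -1 * f z).
  exact: (analyticD (analytic_cst V) (analyticM (analytic_cst (-1)) hf)).
have := @theta_at_vanish N.+1 N _ g z hVf hg; rewrite mulN1r subrr => /(_ erefl (ltnSn _)).
have -> : (fun z => (V + -1 * f z) ^+ N.+1 * g z) =
    (fun z => \sum_(j < N.+2) ((-1) ^+ j * 'C(N.+1, j)%:R * V ^+ (N.+1 - j)) *
       (f z ^+ j * g z)).
  apply/funext => y; rewrite exprDn mulr_suml; apply: eq_bigr => j _.
  by rewrite -[X in X * _]mulr_natr exprMn; ring.
have hj j : analytic (fun z => f z ^+ j * g z).
  exact: (analyticM (analyticX j hf) hg).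
rewrite theta_at_sum; last by move=> j; exact: (analyticM (analytic_cst _) (hj j)).
(* The term [j = 0] is [V^(N+1)] times the wanted [R^N g]; in the others [f^(j+1) * g = f^j * h] no
   longer contains the reciprocal. *)
rewrite big_ord_recl /= expr0 mul1r bin0 mul1r subn0 => /eqP.
rewrite (theta_atZ _ _ _ (hj 0%N)) addr_eq0 => /eqP e.
have VN : V ^+ N.+1 != 0 by rewrite expf_neq0// f0.
rewrite radialE//; apply: (mulfI VN).
have -> : theta_at N g z = theta_at N (fun z => f z ^+ 0 * g z) z.
  by congr (theta_at N _ z); apply/funext => y; rewrite mul1r.
rewrite e -sumrN mulr_sumr; apply: eq_bigr => j _.
rewrite /bump /= add1n (theta_atZ _ _ _ (hj j.+1)) radialE//.
have -> : (fun z => f z ^+ j.+1 * g z) = (fun z => f z ^+ j * h z).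
  by apply/funext => y; rewrite /g exprSr mulrA mulfK.
have -> : V ^+ N.+1 = V ^+ (N.+1 - j.+1) * V ^+ j.+1 by rewrite -exprD subnK.
have Vj : V ^+ j.+1 != 0 by rewrite expf_neq0// f0.
by rewrite exprVn exprS; field.
Qed.

End HomogeneousExpansion.

(** * Closed graph theorem *)

Section ClosedGraph.
Variable R : realType.
Local Notation C := (Cplx R).

Lemma cauchy_mod_cvg (V : completeNormedModType C) (u : nat -> V) (b : nat -> R) :
  b @ \oo --> (0 : R) ->
  (forall k l, (k <= l)%N -> mod (u l - u k) <= b k) -> cvgn u.
Proof.
move=> b0 ub; suff : cauchy (u @ \oo) by exact: cauchy_cvg.
suff : cauchy_ex (u @ \oo) by exact: cauchy_exP.
move=> e e0; have eR : e = (complex.Re e)%:C%C by rewrite RRe_real// gtr0_real.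
have e1 : 0 < complex.Re e by rewrite -ltcR -eR.
have /cvgrPdist_lt/(_ _ e1)[k _ hk] := b0.
exists (u k); rewrite /fmapE -ball_normE /ball_; exists k => // l /= kl.
rewrite normE eR ltcR modBC; apply: (le_lt_trans (ub _ _ kl)).
by have := hk k (leqnn k); rewrite /= sub0r normrN; apply: le_lt_trans; exact: ler_norm.
Qed.

Lemma bounded_mod_continuous (V W : normedModType C) (S : {linear V -> W}) (K : R) :
  (forall x, mod (S x) <= K * mod x) -> continuous S.
Proof.
move=> hK x; apply/cvgrPdist_lt => e e0.
have eR : e = (complex.Re e)%:C%C by rewrite RRe_real// gtr0_real.
have e1 : 0 < complex.Re e by rewrite -ltcR -eR.
have K1 : 0 < `|K| + 1 by rewrite ltr_wpDl.
have d0 : (0 : C) < (complex.Re e / (`|K| + 1))%:C%C by rewrite ltcR divr_gt0.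
have /cvgrPdist_lt/(_ _ d0) : (id : V -> V) @ x --> x by exact: cvg_id.
apply: filterS => y; rewrite !normE ltcR eR ltcR -linearB.
rewrite ltr_pdivlMr// => h; apply: (le_lt_trans (hK _)); apply: le_lt_trans h.
rewrite mulrC ler_wpM2l ?mod_ge0//; have := ler_norm K; lra.
Qed.

Lemma continuous_mod_bounded (V W : normedModType C) (S : {linear V -> W}) :
  continuous S -> exists K : R, 0 < K /\ forall x, mod (S x) <= K * mod x.
Proof.
move=> /(_ 0) /cvgrPdist_lt /(_ 1 ltr01); rewrite linear0.
move=> /nbhs_ballP [e /= e0 he].
have eR : e = (complex.Re e)%:C%C by rewrite RRe_real// gtr0_real.
have e1 : 0 < complex.Re e by rewrite -ltcR -eR.
have hS y : mod y < complex.Re e -> mod (S y) < 1.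
  move=> ye; have := he y; rewrite -ball_normE /= !sub0r !normrN !normE eR ltcR => /(_ ye).
  by rewrite -[1 in X in X -> _]/(1%:C)%C ltcR.
exists (2 / complex.Re e); split; first by rewrite divr_gt0.
move=> x; have [->|x0] := eqVneq x 0; first by rewrite linear0 !mod0 mulr0.
have mx : 0 < mod x by rewrite lt_def mod_ge0 mod_eq0 x0.
pose t := complex.Re e / (2 * mod x).
have t0 : 0 < t by rewrite divr_gt0// mulr_gt0.
have := hS (t%:C%C *: x); rewrite linearZ /= !modZ mod_real gtr0_norm//.
have -> : t * mod x = complex.Re e / 2 by rewrite /t; field; rewrite gt_eqF.
move=> /(_ ltac:(lra)) h.
have -> : 2 / complex.Re e * mod x = t^-1 by rewrite /t; field; rewrite !gt_eqF.
by rewrite -[leRHS]mul1r ler_pdivlMr// mulrC ltW.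
Qed.

(** The sublevel sets of [p] cover the space. If none were dense in a ball, nested closed balls
    could be chosen to avoid them one after another, and their common point would have [p] above
    every integer. Density replaces interior because the sublevel sets may fail to be closed. *)
Lemma baire_sublevel (V : completeNormedModType C) (p : V -> R) :
  exists (N : nat) (x0 : V) (e : R), 0 < e /\ forall y, mod (y - x0) < e ->
    forall d : R, 0 < d -> exists z, p z <= N%:R /\ mod (y - z) < d.
Proof.
apply: contrapT => hno.
have step (q : nat * (V * R)) : exists q' : V * R, 0 < q.2.2 ->
    [/\ 0 < q'.2, q'.2 <= q.2.2 / 2, mod (q'.1 - q.2.1) <= q.2.2 / 2 &
        forall z, mod (q'.1 - z) <= q'.2 -> q.1%:R < p z].
  case: q => N [x r] /=; have [r0|_] := ltP 0 r; last by exists (x, r).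
  have [y [yx [d [d0 hd]]]] : exists y, mod (y - x) < r / 2 /\
      exists d : R, 0 < d /\ forall z, mod (y - z) < d -> N%:R < p z.
    apply: contrapT => hy; apply: hno; exists N, x, (r / 2).
    split; first by rewrite divr_gt0.
    move=> y yx d d0; apply: contrapT => hz; apply: hy; exists y; split => //.
    exists d; split => // z zd; rewrite ltNge; apply/negP => pz.
    by apply: hz; exists z.
  (* Halving [d] lets the closed ball avoid the sublevel set; halving [r] keeps it in the previous
     ball and makes the radii tend to 0. *)
  exists (y, Num.min (d / 2) (r / 2)) => _; split => /=.
  - by rewrite lt_min !divr_gt0.
  - by rewrite ge_min lexx orbT.
  - exact: ltW.
  - move=> z; rewrite le_min => /andP[zd _]; apply: hd; lra.
have [g hg] := choice step.
pose fix ar k : V * R := if k is k'.+1 then g (k', ar k') else (0, 1).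
have r0 k : 0 < (ar k).2.
  by elim: k => //= k ih; have [] := hg (k, ar k) ih.
have r2 k : (ar k.+1).2 <= (ar k).2 / 2 by have [] := hg (k, ar k) (r0 k).
have rx k : mod ((ar k.+1).1 - (ar k).1) <= (ar k).2 / 2.
  by have [] := hg (k, ar k) (r0 k).
have rp k z : mod ((ar k.+1).1 - z) <= (ar k.+1).2 -> k%:R < p z.
  by have [_ _ _] := hg (k, ar k) (r0 k); apply.
have dist k l : (k <= l)%N -> mod ((ar l).1 - (ar k).1) <= (ar k).2 - (ar l).2.
  move=> kl; rewrite -(subnKC kl); elim: (l - k)%N => [|j ih].
    by rewrite addn0 !subrr mod0.
  have h := modD ((ar (k + j).+1).1 - (ar (k + j)%N).1) ((ar (k + j)%N).1 - (ar k).1).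
  rewrite addrA subrK in h; rewrite addnS; apply: (le_trans h).
  have := rx (k + j)%N; have := r2 (k + j)%N; lra.
have rhalf k : (ar k).2 <= 2^-1 ^+ k.
  elim: k => //= k ih; rewrite exprS.
  by have := r2 k; rewrite /=; lra.
have half0 : (fun k => 1 * 2^-1 ^+ k : R) @ \oo --> (0 : R).
  by apply: geometric_cvg0; apply/andP; split; lra.
have /cvg_ex[x hx] : cvgn (fun k => (ar k).1).
  apply: (cauchy_mod_cvg half0) => k l kl; rewrite mul1r.
  by have := dist k l kl; have := rhalf k; have := r0 l; lra.
have xp k : k%:R < p x.
  apply: rp; rewrite modBC.
  apply: (mod_cvg_le (cvgB hx (cvg_cst _))).
  exists k.+1 => // l /= kl; apply: (le_trans (dist _ _ kl)).
  by rewrite gerBl ltW.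
have := xp (Num.trunc (p x)).+1.
have := @Num.Theory.truncnS_gt R (p x).
by move=> h1 /(lt_trans h1); rewrite ltxx.
Qed.

(* Baire gives a level N such that the ball is approximated by points with
   [mod (S z) <= N]; successive approximation at geometrically decreasing scales
   then yields remainders x_k -> 0 with S x_k Cauchy, and the closed graph makes
   the limit of S x_k vanish. *)
Theorem closed_graph_bounded (V W : completeNormedModType C) (S : {linear V -> W}) :
  (forall (u : nat -> V) l, u @ \oo --> (0 : V) -> (S \o u) @ \oo --> l -> l = 0) ->
  exists K : R, forall x, mod (S x) <= K * mod x.
Proof.
move=> hS; have [N [x0 [e [e0 hN]]]] := @baire_sublevel V (fun x => mod (S x)).
(* Subtracting approximations of [x + x0] and of [x0] recentres the ball at 0 and doubles the
   level. *)
have h0 x d : mod x < e -> 0 < d -> exists z, mod (S z) <= 2 * N%:R /\ mod (x - z) < d.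
  move=> xe d0; have d2 : 0 < d / 2 by rewrite divr_gt0.
  have := hN (x + x0); rewrite addrK => /(_ xe _ d2)[z1 [Sz1 z1d]].
  have := hN x0; rewrite subrr mod0 => /(_ e0 _ d2)[z2 [Sz2 z2d]].
  exists (z1 - z2); rewrite linearB; split; first by apply: (le_trans (modB _ _)); lra.
  have -> : x - (z1 - z2) = (x + x0 - z1) - (x0 - z2).
    by rewrite !opprB addrACA [x + x0 + z2]addrAC [- z1 - x0]addrC !addrA addrK.
  by apply: (le_lt_trans (modB _ _)); lra.
have h2 k : 0 < 2^-1 ^+ k :> R by rewrite exprn_gt0.
have hk (q : nat * V) : exists z, mod q.2 < e * 2^-1 ^+ q.1 ->
    mod (S z) <= 2 * N%:R * 2^-1 ^+ q.1 /\ mod (q.2 - z) < e * 2^-1 ^+ q.1.+1.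
  case: q => k x /=; have [xe|_] := ltP (mod x) (e * 2^-1 ^+ k); last by exists 0.
  pose s : R := 2^-1 ^+ k; have s0 : 0 < s := h2 k.
  have ms : mod (s%:C%C : C) = s by rewrite mod_real gtr0_norm.
  have mV : mod ((s%:C%C)^-1 : C) = s^-1 by rewrite modV ms.
  have sC : s%:C%C != 0 :> C by rewrite -mod_eq0 ms gt_eqF.
  have [||z [Sz xz]] := h0 ((s%:C%C)^-1 *: x) (e / 2).
  - by rewrite modZ mV mulrC ltr_pdivrMr.
  - by rewrite divr_gt0.
  exists (s%:C%C *: z) => _; rewrite linearZ /= modZ ms; split.
    by rewrite mulrC ler_wpM2r// ltW.
  have -> : x - s%:C%C *: z = s%:C%C *: ((s%:C%C)^-1 *: x - z).
    by rewrite scalerBr scalerA divff// scale1r.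
  move: xz; rewrite -(ltr_pM2l s0) modZ ms exprS -/s => /lt_le_trans; apply; lra.
have [g hg] := choice hk.
(* The corrections have images bounded by [2 * N * 2^-k], whose sum is [4 * N]. *)
have hsmall x : mod x < e -> mod (S x) <= 4 * N%:R.
  move=> xe; pose fix xs k : V := if k is k'.+1 then xs k' - g (k', xs k') else x.
  have xsk k : mod (xs k) < e * 2^-1 ^+ k.
    by elim: k => [|k ih]; [rewrite expr0 mulr1|have [] := hg (k, xs k) ih].
  have Sg k : mod (S (xs k.+1) - S (xs k)) <= 2 * N%:R * 2^-1 ^+ k.
    by rewrite modBC -linearB /= opprB addrC subrK; have [] := hg (k, xs k) (xsk k).
  have dist k l : (k <= l)%N -> mod (S (xs l) - S (xs k)) <=
      4 * N%:R * (2^-1 ^+ k - 2^-1 ^+ l).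
    move=> kl; rewrite -(subnKC kl); elim: (l - k)%N => [|j ih].
      by rewrite addn0 !subrr mod0 mulr0.
    have h := modD (S (xs (k + j).+1) - S (xs (k + j)%N)) (S (xs (k + j)%N) - S (xs k)).
    rewrite addrA subrK in h; rewrite addnS; apply: (le_trans h).
    have := Sg (k + j)%N; rewrite [2^-1 ^+ (k + j).+1]exprS; lra.
  have N0 : 0 <= N%:R :> R by [].
  have half0 (a : R) : (fun k => a * 2^-1 ^+ k : R) @ \oo --> (0 : R).
    by apply: geometric_cvg0; apply/andP; split; lra.
  have /cvg_ex[l hl] : cvgn (S \o xs).
    apply: (cauchy_mod_cvg (half0 (4 * N%:R))) => k l kl; apply: (le_trans (dist k l kl)).
    by rewrite ler_wpM2l ?mulr_ge0// gerBl ltW.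
  have xs0 : xs @ \oo --> (0 : V).
    apply: (@cvg_mod_le _ _ _ _ (fun k => e * 2^-1 ^+ k)); last exact: half0.
    by move=> k; rewrite subr0 ltW.
  have l0 := hS xs l xs0 hl; rewrite l0 in hl.
  have hx k : mod (S (xs k) - S x) <= 4 * N%:R.
    apply: (le_trans (dist 0%N k (leq0n k))).
    by rewrite expr0 ler_piMr ?mulr_ge0// gerBl.
  rewrite -modN -[- S x]add0r; apply: (mod_cvg_le (cvgB hl (cvg_cst (S x)))).
  exact: nearW.
exists (8 * N%:R / e) => x; have [->|x0'] := eqVneq x 0.
  by rewrite linear0 !mod0 mulr0.
have mx : 0 < mod x by rewrite lt_def mod_ge0 mod_eq0 x0'.
pose t := e / (2 * mod x); have t0 : 0 < t by rewrite divr_gt0// mulr_gt0.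
have := hsmall (t%:C%C *: x); rewrite linearZ /= !modZ mod_real gtr0_norm//.
have -> : t * mod x = e / 2 by rewrite /t; field; rewrite gt_eqF.
move=> /(_ ltac:(lra)) h.
have -> : 8 * N%:R / e * mod x = (4 * N%:R) / t by rewrite /t; field; rewrite !gt_eqF.
by rewrite ler_pdivlMr// mulrC.
Qed.

End ClosedGraph.

(** * Evaluations and multiplication operators on a function space *)

Section FunctionSpace.
Variables (R : realType) (n : nat).
Local Notation C := (Cplx R).
Implicit Types (Z : banach_fun_space R n) (f g : Bn R n -> C).

(** Points are compact, so compact-open convergence includes convergence at each point. *)
Lemma evaluation_cvg Z (z : Bn R n) (u : nat -> Z) (x : Z) :
  finer_than_compact_open Z -> u @ \oo --> x ->
  (fun k => bfs_fun (u k) z : C) @ \oo --> (bfs_fun x z : C).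
Proof.
move=> hZ ux; have : (fun k => bfs_fun (u k) : {compact-open, Bn R n -> C}) @ \oo -->
    (bfs_fun x : {compact-open, Bn R n -> C}) by exact: (cvg_comp _ _ ux (hZ x)).
move=> /compact_open_cvgP h; apply/cvgrPdist_lt => e e0.
have := h [set z] (ball (bfs_fun x z : C) e) (@compact_set1 _ z) (ball_open (bfs_fun x z : C) e).
have hz : [set bfs_fun x y | y in [set z]] `<=` ball (bfs_fun x z : C) e.
  by move=> _ [y -> <-]; exact: ballxx.
move=> /(_ hz) hu.
have : \forall k \near \oo, [set bfs_fun (u k) y | y in [set z]] `<=` ball (bfs_fun x z : C) e.
  exact: hu.
apply: filterS => k /= hk.
have := hk (bfs_fun (u k) z); rewrite -ball_normE; apply.
by exists z.
Qed.

(** The algebraic half of [multiplier], kept apart so that powers, shifts and reciprocals can be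
    treated without carrying analyticity along. *)
Definition closed_under Z g : Prop :=
  forall x : Z, exists y : Z, bfs_fun y = (fun z => g z * bfs_fun x z).

Lemma mult_opE Z g x : closed_under Z g ->
  bfs_fun (mult_op Z g x) = (fun z => g z * bfs_fun x z).
Proof. by move=> /(_ x) [y hy]; rewrite /mult_op; case: xgetP => [//|/(_ y)]. Qed.

Lemma mult_op_linear Z g : closed_under Z g -> linear (mult_op Z g).
Proof.
move=> hg a x y; apply: (@bfs_inj _ _ Z); rewrite linearP !mult_opE// linearP.
apply/funext => z; rewrite /= !fctE; rewrite /GRing.scale /=; ring.
Qed.

(** The graph is closed by evaluation: if [u k] tends to 0 then [g z * u k z] tends to 0 at every
    [z], so a limit of the images vanishes pointwise. *)
Lemma mult_op_bounded Z g (S : {linear Z -> Z}) : finer_than_compact_open Z ->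
  closed_under Z g -> S =1 mult_op Z g -> continuous S.
Proof.
move=> hZ hg hS.
have [K hK] : exists K : R, forall x, mod (S x) <= K * mod x.
  apply: closed_graph_bounded => u l u0 Sul; apply: (@bfs_inj _ _ Z).
  rewrite linear0; apply/funext => z.
  have h1 := evaluation_cvg (z := z) hZ Sul; have h2 := evaluation_cvg (z := z) hZ u0.
  have h3 : ((fun=> g z) \* (fun k => bfs_fun (u k) z : C)) @ \oo --> (0 : C).
    rewrite -(mulr0 (g z)) -[X in g z * X]/((0 : Bn R n -> C^o) z) -(linear0 (@bfs_fun _ _ Z)).
    exact: (cvgM (cvg_cst (g z)) h2).
  have e : (fun k => bfs_fun ((S \o u) k) z : C) = (fun=> g z) \* (fun k => bfs_fun (u k) z).
    by apply/funext => k /=; rewrite hS mult_opE.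
  by rewrite e in h1; exact: cvg_unique h1 h3.
exact: bounded_mod_continuous hK.
Qed.

End FunctionSpace.

(** * The spectrum *)

Section Spectrum.
Variables (R : realType) (n : nat).
Local Notation C := (Cplx R).
Implicit Types (X Y Z : banach_fun_space R n) (f g h u : Bn R n -> C).

Definition in_space Z f : Prop := exists x : Z, bfs_fun x = f.

Lemma enorm_ltyP Z f : in_space Z f <-> (enorm Z f < +oo)%E.
Proof.
split=> [[x xf]|].
  apply: (@le_lt_trans _ _ (complex.Re `|x|)%:E); last exact: ltry.
  by apply: ereal_inf_lbound; exists x.
move=> h; apply: contrapT => nf; move: h; rewrite /enorm.
rewrite (_ : [set _ | _ in _] = set0) ?ereal_inf0 ?ltxx//.
by apply/seteqP; split=> // y [x xf _]; case: nf; exists x.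
Qed.

Lemma enorm_ge0 Z f : (0 <= enorm Z f)%E.
Proof.
apply: le_ereal_inf_tmp => _ [x _ <-].
by rewrite lee_fin; exact: mod_ge0.
Qed.

(** The term [|f(0)|] is finite and the constant is positive, so the two norms are finite together,
    and finiteness is membership. *)
Lemma norm_equivalenceP N X Y f : norm_equivalence N X Y -> analytic f ->
  in_space X f <-> in_space Y (radial N f).
Proof.
move=> [K K0 hK] /hK /= [h1 h2]; split=> /enorm_ltyP hf; apply/enorm_ltyP.
  have := le_lt_trans h1 hf; rewrite !ltey; apply: contra_neq => ->.
  by rewrite addey// gt0_muley// lte_fin invr_gt0.
apply: (le_lt_trans h2); rewrite -ge0_fin_numE in hf; last exact: enorm_ge0.
by rewrite -(fineK hf) -EFinD -EFinM ltry.
Qed.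

Lemma in_spaceD Z f g : in_space Z f -> in_space Z g -> in_space Z (fun z => f z + g z).
Proof. by move=> [x <-] [y <-]; exists (x + y); rewrite linearD. Qed.

Lemma in_spaceZ Z (a : C) f : in_space Z f -> in_space Z (fun z => a * f z).
Proof. by move=> [x <-]; exists (a *: x); rewrite linearZ. Qed.

Lemma in_space_sum Z (I : Type) (r : seq I) (f : I -> Bn R n -> C) :
  (forall i, in_space Z (f i)) -> in_space Z (fun z => \sum_(i <- r) f i z).
Proof.
move=> hf; elim: r => [|i r ih].
  by exists 0; rewrite linear0; apply/funext => z; rewrite big_nil.
have := in_spaceD (hf i) ih; congr (in_space Z _).
by apply/funext => z; rewrite big_cons.
Qed.

Lemma closed_underP Z g : closed_under Z g <->
  forall f, in_space Z f -> in_space Z (fun z => g z * f z).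
Proof.
split=> [h f [x <-]|h x]; first by have [y hy] := h x; exists y.
by apply: h; exists x.
Qed.

Lemma closed_underX Z g k : closed_under Z g -> closed_under Z (fun z => g z ^+ k).
Proof.
move=> /closed_underP hg; apply/closed_underP => f hf; elim: k => [|k ih].
  by under eq_fun do rewrite expr0 mul1r.
by under eq_fun do rewrite exprS -mulrA; exact: hg.
Qed.

Lemma closed_under_shift Z g (a : C) : closed_under Z g -> closed_under Z (fun z => g z - a).
Proof.
move=> /closed_underP hg; apply/closed_underP => f hf.
have := in_spaceD (hg f hf) (in_spaceZ (- a) hf); congr (in_space Z _).
by apply/funext => z; rewrite mulrDl.
Qed.

(** Condition (II) serves in both directions: it sends each [v^j h] from [X] to [Y], and brings
    [h / v] back to [X] once its image under [R^N] is known to be in [Y]. *)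
Lemma closed_under_inv N X Y v : (0 < N)%N -> norm_equivalence N X Y ->
  analytic v -> (forall z, v z != 0) -> closed_under X v ->
  closed_under Y (fun z => (v z)^-1) -> closed_under X (fun z => (v z)^-1).
Proof.
move=> N0 hN av v0 vX vY; apply/closed_underP => h [x hx].
have ah : analytic h by rewrite -hx; exact: bfs_analytic.
apply/(norm_equivalenceP hN (analyticM (analyticV v0 av) ah)).
rewrite (_ : radial N _ = fun z => \sum_(j < N.+1) ((-1) ^+ j * 'C(N.+1, j.+1)%:R) *
     ((v z)^-1 ^+ j.+1 * radial N (fun z => v z ^+ j * h z) z)); last first.
  by apply/funext => z; rewrite radial_div.
apply: in_space_sum => j; apply: in_spaceZ.
apply: (proj1 (closed_underP _ _) (closed_underX j.+1 vY)).
apply/(norm_equivalenceP hN (analyticM (analyticX j av) ah)).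
by apply: (proj1 (closed_underP _ _) (closed_underX j vX)); exists x.
Qed.

Lemma not_closure_range u (a : C) : ~ closure (range u) a ->
  exists2 d : R, 0 < d & forall z, d <= mod (u z - a).
Proof.
move=> ha; apply: contrapT => hd; apply: ha => O /nbhs_ballP [e /= e0 eO].
have eR : e = (complex.Re e)%:C%C by rewrite RRe_real// gtr0_real.
have e1 : 0 < complex.Re e by rewrite -ltcR -eR.
apply: contrapT => hO; apply: hd; exists (complex.Re e) => // z.
rewrite leNgt; apply/negP => ze; apply: hO; exists (u z); split; first by exists z.
by apply: eO; rewrite -ball_normE /= normE eR ltcR modBC.
Qed.

Lemma Hinfty_inv v (d : R) : 0 < d -> (forall z, d <= mod (v z)) -> analytic v ->
  Hinfty R n (fun z => (v z)^-1).
Proof.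
move=> d0 vd av; have v0 z : v z != 0.
  by rewrite -mod_eq0 gt_eqF// (lt_le_trans d0).
split; first exact: analyticV.
exists (d^-1)%:C%C; split; first by rewrite realE ler0c invr_ge0 (ltW d0).
move=> M dM z _ /=; apply: le_trans (ltW dM).
change (`|(v z)^-1 : C| <= (d^-1)%:C%C).
by rewrite normE lecR modV lef_pV2 ?posrE// (lt_le_trans d0).
Qed.

Lemma closure_sub_spectrum X u : contains_constants X -> finer_than_compact_open X ->
  closed_under X u -> closure (range u) `<=` spectrum (mult_op X u).
Proof.
move=> hX1 hX uX a ca [S [cS Sl Sr]].
have [e he] := hX1 1.
have [K [K0 hK]] := continuous_mod_bounded cS.
have uS x z : (u z - a) * bfs_fun (S x) z = bfs_fun x z.
  rewrite -[in RHS](Sr x) linearB linearZ mult_opE//= !fctE.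
  by rewrite mulrBl.
pose g z : C := bfs_fun (S e) z.
have gu z : g z * (u z - a) = 1 by rewrite mulrC uS he.
have g0 z : g z != 0.
  by apply: contra_eq_neq (gu z) => ->; rewrite mul0r eq_sym oner_eq0.
have iterSE k z : bfs_fun (iter k S e) z = g z ^+ k.
  elim: k => [|k ih]; first by rewrite /= he.
  apply: (mulfI (x := u z - a)); last by rewrite iterS uS ih exprS mulrA [X in X * _]mulrC gu mul1r.
  by apply: contra_eq_neq (gu z) => ->; rewrite mulr0 eq_sym oner_eq0.
have miter k : mod (iter k S e) <= K ^+ k * mod e.
  elim: k => [|k ih]; first by rewrite expr0 mul1r.
  by rewrite iterS exprS -mulrA (le_trans (hK _))// ler_wpM2l// ltW.
(* Otherwise the vectors [g(z)^-k S^k e] would tend to 0 in [X] while all taking the value 1 at [z],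
   against the continuity of evaluation. *)
have gK z : mod (g z) <= K.
  rewrite leNgt; apply/negP => Kg.
  have mg : 0 < mod (g z) := lt_trans K0 Kg.
  pose x k := (g z ^- k) *: iter k S e.
  have x0 : x @ \oo --> (0 : X).
    apply: (@cvg_mod_le _ _ _ _ (fun k => mod e * (K / mod (g z)) ^+ k)).
      move=> k; rewrite subr0 modZ modV modX.
      rewrite expr_div_n mulrC mulrA ler_pM2r ?invr_gt0 ?exprn_gt0// mulrC.
      exact: miter.
    apply: geometric_cvg0; rewrite divr_ge0 ?(ltW K0) ?(ltW mg)//=.
    by rewrite ltr_pdivrMr// mul1r.
  have h1 := evaluation_cvg (z := z) hX x0.
  have e1 : (fun k => bfs_fun (x k) z : C) = fun=> 1.
    apply/funext => k; rewrite /x linearZ /= !fctE iterSE.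
    by rewrite [LHS]mulVf// expf_neq0.
  rewrite e1 in h1; have h2 : (fun=> 1 : C) @ \oo --> (1 : C) by exact: cvg_cst.
  rewrite linear0 in h1; have /eqP : (1 : C) = 0 by exact: cvg_unique h2 h1.
  by rewrite oner_eq0.
have Kinv : 0 < K^-1 by rewrite invr_gt0.
(* A value of [u] within [1 / K] of [a] makes [mod (g z) * mod (u z - a)] less than 1, although this
   product equals 1. *)
have /ca [_ [[z _ <-]]] : nbhs a (ball a (K^-1)%:C%C) by apply: nbhsx_ballx; rewrite ltcR.
rewrite -ball_normE /= normE ltcR modBC => uz.
have : mod (g z) * mod (u z - a) < 1.
  apply: (@le_lt_trans _ _ (K * mod (u z - a))).
    by rewrite ler_wpM2r ?mod_ge0.
  by rewrite mulrC -ltr_pdivlMr// mul1r.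
by rewrite -modM gu mod1 ltxx.
Qed.

Lemma spectrum_sub_closure X Y (N : nat) u : (0 < N)%N -> norm_equivalence N X Y ->
  finer_than_compact_open X -> Hinfty R n `<=` multiplier Y -> multiplier X u ->
  spectrum (mult_op X u) `<=` closure (range u).
Proof.
move=> N0 hN hX hY [au uX] a; apply: contraPP => /not_closure_range [d d0 ud] hs.
pose v z := u z - a.
have av : analytic v := analyticD au (analytic_cst (- a)).
have v0 z : v z != 0 by rewrite -mod_eq0 gt_eqF//; exact: lt_le_trans d0 (ud z).
have [_ vY] := hY _ (Hinfty_inv d0 ud av).
have vX : closed_under X (fun z => (v z)^-1).
  by apply: closed_under_inv hN av v0 _ vY => //; exact: closed_under_shift.
pose S : {linear X -> X} := HB.pack (mult_op X (fun z => (v z)^-1))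
  (GRing.isLinear.Build C X X *:%R _ (mult_op_linear vX)).
apply: hs; exists S; split.
- exact: (mult_op_bounded hX vX).
- move=> x; apply: (@bfs_inj _ _ X); rewrite mult_opE// linearB linearZ mult_opE//=.
  apply/funext => z; rewrite !fctE.
  by rewrite -[X in _ * (_ - X)]/(a * bfs_fun x z : C) -mulrBl mulKf.
- move=> x; apply: (@bfs_inj _ _ X); rewrite linearB linearZ mult_opE// mult_opE//=.
  apply/funext => z; rewrite !fctE.
  by rewrite -[X in (_ - X)]/(a * ((v z)^-1 * bfs_fun x z) : C) -mulrBl -/(v z) mulVKf.
Qed.

End Spectrum.

Theorem theorem3p2 (R : realType) (n : nat) (hn : (1 <= n)%N)
  (X Y : banach_fun_space R n)
  (hX1 : contains_constants X) (hY1 : contains_constants Y)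
  (hIX : finer_than_compact_open X) (hIY : finer_than_compact_open Y)
  (hII : exists2 N : nat, (1 <= N)%N & norm_equivalence N X Y)
  (hIII : Hinfty R n `<=` multiplier Y)
  (u : Bn R n -> Cplx R) (hu : multiplier X u) :
  spectrum (mult_op X u) = closure (range u).
Proof.
have [N N0 hN] := hII; apply/seteqP; split.
- exact: spectrum_sub_closure N0 hN hIX hIII hu.
- exact: closure_sub_spectrum hX1 hIX (proj2 hu).
Qed.
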